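(* Let $p$ be an odd prime, let $m\geq 3$ and $l$ be positive integers with $\gcd(m,l)=1$, let $q=p^m$, and let $\mathrm{Tr}$ denote the trace function from $\mathbb{F}_q$ onto $\mathbb{F}_p$. Fix an ordering of the elements of $\mathbb{F}_q$ and consider the linear code over $\mathbb{F}_p$ of length $p^m$ $$\mathcal{D}_1=\{(\mathrm{Tr}(ax^{p^l+1}+bx^2+cx)+h)_{x\in\mathbb{F}_q} : a,b,c\in\mathbb{F}_q,\ h\in\mathbb{F}_p\}.$$ Then $\dim \mathcal{D}_1 = 3m+1$, and its weight distribution (weight: number of codewords of that weight) is as follows. If $m$ is odd: - $0$: $1$; - $p^{m-1}(p-1)$: $p(2p^{2m-1}-2p^{2m-2}+p^{2m-3}-p^{2m-4}+p^{m-1}-p^{m-2}+2)(p^m-1)$; - $p^{\frac{m-1}{2}}(p^{\frac{m+1}{2}}-p^{\frac{m-1}{2}}-p+1)$: $\frac{1}{2}p^{\frac{3m-3}{2}}(p^m-1)(p^{\frac{m-1}{2}}+1)$; - $p^{\frac{m-1}{2}}(p^{\frac{m+1}{2}}-p^{\frac{m-1}{2}}+p-1)$: $\frac{1}{2}p^{\frac{3m-3}{2}}(p^m-1)(p^{\frac{m-1}{2}}-1)$; - $p^{\frac{m-1}{2}}(p^{\frac{m+1}{2}}-p^{\frac{m-1}{2}}+1)$: $\frac{p^m(p^m-1)(p^{m+2}-p^{m+1}-p^{m-2}+p^{\frac{m+1}{2}}-p^{\frac{m-3}{2}}+p^2)}{2(p+1)}$; - $p^{\frac{m-1}{2}}(p^{\frac{m+1}{2}}-p^{\frac{m-1}{2}}-1)$: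 $\frac{p^m(p^m-1)(p^{m+2}-p^{m+1}-p^{m-2}-p^{\frac{m+1}{2}}+p^{\frac{m-3}{2}}+p^2)}{2(p+1)}$; - $p^{\frac{m+1}{2}}(p^{\frac{m-1}{2}}-p^{\frac{m-3}{2}}+1)$: $\frac{1}{2}p^{m-2}(p^m-1)(p^{m-1}-1)/(p+1)$; - $p^{\frac{m+1}{2}}(p^{\frac{m-1}{2}}-p^{\frac{m-3}{2}}-1)$: $\frac{1}{2}p^{m-2}(p^m-1)(p^{m-1}-1)/(p+1)$; - $p^m$: $p-1$. If $m$ is even: - $0$: $1$; - $p^{m-1}(p-1)$: $p(p^{2m-1}-p^{2m-2}+2p^{2m-3}-p^{m-2}+1)(p^m-1)$; - $p^{\frac{m-2}{2}}(p^{\frac{m+2}{2}}-p^{\frac{m}{2}}-p+1)$: $\frac{p^{m+2}(p^m-1)(p^m-p^{m-1}-p^{m-2}+p^{\frac{m}{2}}-p^{\frac{m-2}{2}}+1)}{2(p^2-1)}$; - $p^{\frac{m}{2}}(p^{\frac{m}{2}}-p^{\frac{m-2}{2}}-p+1)$: $\frac{1}{2}p^{m-2}(p^m-1)(p^{\frac{m}{2}}-1)(p^{\frac{m-2}{2}}+1)/(p^2-1)$; - $p^{\frac{m-2}{2}}(p^{\frac{m+2}{2}}-p^{\frac{m}{2}}+p-1)$: $\frac{p^{m+2}(p^m-1)(p^m-p^{m-1}-p^{m-2}-p^{\frac{m}{2}}+p^{\frac{m-2}{2}}+1)}{2(p^2-1)}$; - $p^{\frac{m}{2}}(p^{\frac{m}{2}}-p^{\frac{m-2}{2}}+p-1)$: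 $\frac{1}{2}p^{m-2}(p^m-1)(p^{\frac{m}{2}}+1)(p^{\frac{m-2}{2}}-1)/(p^2-1)$; - $p^{\frac{m-2}{2}}(p^{\frac{m+2}{2}}-p^{\frac{m}{2}}+1)$: $\frac{p^{m+2}(p^m-1)(p^m-p^{m-1}-p^{m-2}+p^{\frac{m}{2}}-p^{\frac{m-2}{2}}+1)}{2(p+1)}$; - $p^{\frac{m}{2}}(p^{\frac{m}{2}}-p^{\frac{m-2}{2}}+1)$: $\frac{p^{m-2}(p^m-1)(p^{m+2}-p^m+p^{m-1}+p^{\frac{m}{2}}-p^{\frac{m-2}{2}}-1)}{2(p+1)}$; - $p^{\frac{m-2}{2}}(p^{\frac{m+2}{2}}-p^{\frac{m}{2}}-1)$: $\frac{p^{m+2}(p^m-1)(p^m-p^{m-1}-p^{m-2}-p^{\frac{m}{2}}+p^{\frac{m-2}{2}}+1)}{2(p+1)}$; - $p^{\frac{m}{2}}(p^{\frac{m}{2}}-p^{\frac{m-2}{2}}-1)$: $\frac{p^{m-2}(p^m-1)(p^{m+2}-p^m+p^{m-1}-p^{\frac{m}{2}}+p^{\frac{m-2}{2}}-1)}{2(p+1)}$; - $p^m$: $p-1$.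
   Context: In the paper this code is denoted $\overline{\mathcal{C}_1^{\perp}}^{\perp}$, where $\mathcal{C}_1$ is the cyclic code of length $p^m-1$ over $\mathbb{F}_p$ whose parity-check polynomial is the product of the minimal polynomials over $\mathbb{F}_p$ of $\alpha,\alpha^2,\alpha^{p^l+1}$ for a primitive element $\alpha$ of $\mathbb{F}_q$. The Hamming weight of a codeword is its number of nonzero coordinates.
   Formalization: For m odd, the frequency of weight p^{m-1}(p-1) has p^{m-3}+1 in place of the final 2 (equal only for m=3; with 2 the frequencies do not sum to p^{3m+1} for m≥5); frequencies of rows with the same weight are added (for m=3, the seventh row also has weight p^m). *)

(* Defs.v *)
From HB Require Import structures.
From mathcomp Require Import all_boot all_order all_fingroup all_algebra.
From mathcomp Require Import all_solvable all_field.

Set Implicit Arguments.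
Unset Strict Implicit.
Unset Printing Implicit Defensive.

Import GRing.Theory.
Local Open Scope ring_scope.

Section Code.

Variables (p m l : nat) (F : finFieldType) (charFp : p \in [pchar F]).

(* F with its canonical 'F_p-algebra structure. *)
Let L := pPrimeCharType charFp.

(* [galTrace] takes its values in F; [FpTrace x] is the element of 'F_p whose *)
(* image in F is the trace of x. It exists by [FpTraceE].                     *)
Definition FpTrace (x : F) : 'F_p :=
  odflt 0 [pick t : 'F_p | t%:A == galTrace 1 {:L} x :> L].

(* The ordering e of the elements of F is the order of the coordinates. *)
Definition codeword (e : 'I_(p ^ m) -> F) (a b c : F) (h : 'F_p) :
    'rV['F_p]_(p ^ m) :=
  \row_i (FpTrace (a * e i ^+ (p ^ l).+1 + b * e i ^+ 2 + c * e i) + h).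

Definition code (e : 'I_(p ^ m) -> F) : {set 'rV['F_p]_(p ^ m)} :=
  [set w | [exists a : F, exists b : F, exists c : F, exists h : 'F_p,
     w == codeword e a b c h]].

Lemma FpTraceE (x : F) : (FpTrace x)%:A = galTrace 1 {:L} x :> L.
Proof.
rewrite /FpTrace; case: pickP => [t /eqP //|no_t].
have: galTrace 1 {:L} x \in (1%VS : {vspace L}).
  by apply: mem_galTrace (memvf _); apply: finField_galois; apply: subvf.
by case/vlineP=> t tE; move: (no_t t); rewrite tE eqxx.
Qed.

Lemma Fp_alg_inj (s t : 'F_p) : s%:A = t%:A :> L -> s = t.
Proof. exact: (fmorph_inj (in_alg L)). Qed.

Lemma FpTraceD : {morph FpTrace : x y / x + y}.
Proof.
move=> x y; apply: Fp_alg_inj; rewrite scalerDl !FpTraceE.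
exact: (raddfD (galTrace 1 {:L})).
Qed.

Lemma FpTraceZ (t : 'F_p) (x : F) : FpTrace (t *: (x : L)) = t * FpTrace x.
Proof.
apply: Fp_alg_inj; rewrite -scalerA !FpTraceE /galTrace scaler_sumr.
by apply: eq_bigr => g _; rewrite linearZ.
Qed.

Lemma FpTrace_Frobenius (x : F) :
  #|F| = (p ^ m)%N -> (FpTrace x)%:A = \sum_(i < m) x ^+ (p ^ i) :> L.
Proof.
move=> cardF; rewrite FpTraceE.
have p_pr : prime p := pcharf_prime charFp.
have dimL : \dim {:L} = m.
  rewrite pprimeChar_dimf cardF; exact: pfactorK.
have [s genG sE] := @finField_galois_generator _ L 1%AS {:L}%AS (subvf _).
have sE' k y : (s ^+ k)%g y = y ^+ (p ^ k) :> L.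
  elim: k y => [|k IHk] y; first by rewrite gal_id expr1.
  rewrite expgSr galM ?memvf // sE ?memvf // IHk.
  rewrite dimv1 expn1 card_Fp //.
  by rewrite -exprM -expnSr.
have ordG : #|'Gal({:L} / 1%AS)%g| = m.
  rewrite -galois_dim ?dimv1 ?divn1 ?dimL //.
  by apply: finField_galois; apply: subvf.
have ords : #[s]%g = m by rewrite -ordG; rewrite (eqP genG).
rewrite /galTrace (eq_bigl (mem <[s]>%g)); last first.
  by move=> g; rewrite -(eqP genG).
rewrite -ords.
rewrite (reindex (fun i : 'I_#[s]%g => (s ^+ i)%g)) /=.
  by apply: eq_big => [i|i _]; rewrite ?mem_cycle ?sE'.
have ltm g : g \in <[s]>%g -> exists i : 'I_#[s]%g, g == (s ^+ i)%g.
  by case/cyclePmin=> i lt_i ->; exists (Ordinal lt_i).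
exists (fun g => odflt (Ordinal (order_gt0 s)) [pick i : 'I_#[s]%g | g == (s ^+ i)%g]).
  move=> i _; case: pickP => [j /eqP/eqP|/(_ i)]; last by rewrite eqxx.
  by rewrite eq_expg_mod_order !modn_small // => /eqP/val_inj.
move=> g sg; case: pickP => [j /eqP //|no_i].
by have [i gi] := ltm g sg; rewrite no_i in gi.
Qed.

Lemma codeP (e : 'I_(p ^ m) -> F) (w : 'rV['F_p]_(p ^ m)) :
  reflect (exists a b c h, w = codeword e a b c h) (w \in code e).
Proof.
rewrite inE; apply: (iffP existsP) => [[a /existsP[b /existsP[c]]]|].
  by case/existsP=> h /eqP ->; exists a, b, c, h.
case=> a [b] [c] [h] ->; exists a; apply/existsP; exists b.
by apply/existsP; exists c; apply/existsP; exists h.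
Qed.

Let distr (t : 'F_p) (a b c a' b' c' x y z : L) :
  (t *: a + a') * x + (t *: b + b') * y + (t *: c + c') * z =
  t *: (a * x + b * y + c * z) + (a' * x + b' * y + c' * z).
Proof.
rewrite !mulrDl -!scalerAl [in RHS]scalerDr [in RHS]scalerDr.
by rewrite (addrACA (t *: (a * x))) (addrACA (t *: (a * x) + _)).
Qed.

Lemma code_span (e : 'I_(p ^ m) -> F) : <<enum (code e)>>%VS =i code e.
Proof.
move=> w; apply/idP/idP=> [|Cw]; last by apply: memv_span; rewrite mem_enum.
have code0 : 0 \in code e.
  apply/codeP; exists 0, 0, 0, 0; apply/rowP=> i; rewrite !mxE !mul0r !addr0.
  have -> : (0 : F) = 0 *: (0 : L) by rewrite scale0r.
  by rewrite FpTraceZ mul0r.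
have codeD t u v : u \in code e -> v \in code e -> t *: u + v \in code e.
  case/codeP=> a [b] [c] [h ->] /codeP[a'] [b'] [c'] [h' ->].
  apply/codeP.
  exists (t *: (a : L) + a' : L), (t *: (b : L) + b' : L).
  exists (t *: (c : L) + c' : L), (t * h + h').
  apply/rowP=> i; rewrite !mxE mulrDr -FpTraceZ addrACA -FpTraceD.
  congr (FpTrace _ + _).
  exact: (esym (distr t _ _ _ _ _ _ _ _ _)).
move/coord_span->; elim/big_ind: _ => // [u v Cu Cv|i _].
  by rewrite -[u]scale1r codeD.
rewrite -[_ *: _]addr0 codeD //.
by rewrite -mem_enum mem_nth // -cardE.
Qed.

End Code.

Definition hweight (p n : nat) (w : 'rV['F_p]_n) : nat :=
  #|[set i | w 0 i != 0]|.

Definition code_dim (p n : nat) (C : {set 'rV['F_p]_n}) : nat :=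
  \dim <<enum C>>%VS.

(* Rows (weight, number of codewords). Rows may share a weight: for m = 3 the *)
(* weight of the seventh row is p ^ m, that of the last one. The frequency of *)
(* a weight is the sum over the rows that carry it.                           *)
Definition weight_dist (p n : nat) (C : {set 'rV['F_p]_n})
    (table : seq (rat * rat)) : Prop :=
  forall w : nat, #|[set c in C | hweight c == w]|%:R =
    \sum_(r <- table | r.1 == w%:R) r.2.

(* The second frequency is printed in the source with 2 in place of           *)
(* p ^ (m - 3) + 1. The two agree for m = 3; for odd m > 3 the frequencies    *)
(* with 2 do not add up to the number p ^ (3 m + 1) of codewords.             *)
Definition table_odd (p m : nat) : seq (rat * rat) :=
  let p := p%:R : rat in
  let P k := p ^+ k in
  let m1 := ((m - 1) %/ 2)%N in
  let m3 := ((m - 3) %/ 2)%N in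
  let n1 := ((m + 1) %/ 2)%N in
  [:: (0, 1);
      (P (m - 1)%N * (p - 1),
       p * (2 * P (2 * m - 1)%N - 2 * P (2 * m - 2)%N + P (2 * m - 3)%N
            - P (2 * m - 4)%N + P (m - 1)%N - P (m - 2)%N + P (m - 3)%N + 1)
         * (P m - 1));
      (P m1 * (P n1 - P m1 - p + 1),
       1 / 2 * P ((3 * m - 3) %/ 2)%N * (P m - 1) * (P m1 + 1));
      (P m1 * (P n1 - P m1 + p - 1),
       1 / 2 * P ((3 * m - 3) %/ 2)%N * (P m - 1) * (P m1 - 1));
      (P m1 * (P n1 - P m1 + 1),
       P m * (P m - 1) * (P (m + 2)%N - P (m + 1)%N - P (m - 2)%N
                          + P n1 - P m3 + P 2) / (2 * (p + 1)));
      (P m1 * (P n1 - P m1 - 1),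
       P m * (P m - 1) * (P (m + 2)%N - P (m + 1)%N - P (m - 2)%N
                          - P n1 + P m3 + P 2) / (2 * (p + 1)));
      (P n1 * (P m1 - P m3 + 1),
       1 / 2 * P (m - 2)%N * (P m - 1) * (P (m - 1)%N - 1) / (p + 1));
      (P n1 * (P m1 - P m3 - 1),
       1 / 2 * P (m - 2)%N * (P m - 1) * (P (m - 1)%N - 1) / (p + 1));
      (P m, p - 1)].

Definition table_even (p m : nat) : seq (rat * rat) :=
  let p := p%:R : rat in
  let P k := p ^+ k in
  let m0 := (m %/ 2)%N in
  let m2 := ((m - 2) %/ 2)%N in
  let n2 := ((m + 2) %/ 2)%N in
  [:: (0, 1);
      (P (m - 1)%N * (p - 1),
       p * (P (2 * m - 1)%N - P (2 * m - 2)%N + 2 * P (2 * m - 3)%N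
            - P (m - 2)%N + 1) * (P m - 1));
      (P m2 * (P n2 - P m0 - p + 1),
       P (m + 2)%N * (P m - 1)
         * (P m - P (m - 1)%N - P (m - 2)%N + P m0 - P m2 + 1)
         / (2 * (P 2 - 1)));
      (P m0 * (P m0 - P m2 - p + 1),
       1 / 2 * P (m - 2)%N * (P m - 1) * (P m0 - 1) * (P m2 + 1) / (P 2 - 1));
      (P m2 * (P n2 - P m0 + p - 1),
       P (m + 2)%N * (P m - 1)
         * (P m - P (m - 1)%N - P (m - 2)%N - P m0 + P m2 + 1)
         / (2 * (P 2 - 1)));
      (P m0 * (P m0 - P m2 + p - 1),
       1 / 2 * P (m - 2)%N * (P m - 1) * (P m0 + 1) * (P m2 - 1) / (P 2 - 1));
      (P m2 * (P n2 - P m0 + 1),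
       P (m + 2)%N * (P m - 1)
         * (P m - P (m - 1)%N - P (m - 2)%N + P m0 - P m2 + 1)
         / (2 * (p + 1)));
      (P m0 * (P m0 - P m2 + 1),
       P (m - 2)%N * (P m - 1)
         * (P (m + 2)%N - P m + P (m - 1)%N + P m0 - P m2 - 1)
         / (2 * (p + 1)));
      (P m2 * (P n2 - P m0 - 1),
       P (m + 2)%N * (P m - 1)
         * (P m - P (m - 1)%N - P (m - 2)%N - P m0 + P m2 + 1)
         / (2 * (p + 1)));
      (P m0 * (P m0 - P m2 - 1),
       P (m - 2)%N * (P m - 1)
         * (P (m + 2)%N - P m + P (m - 1)%N - P m0 + P m2 - 1)
         / (2 * (p + 1)));
      (P m, p - 1)].

(* Main.v *)
Require Import Defs.
From mathcomp Require Import all_boot all_order all_fingroup all_algebra.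
From mathcomp Require Import all_solvable all_field.
From mathcomp Require Import zify ring lra.

Set Implicit Arguments.
Unset Strict Implicit.
Unset Printing Implicit Defensive.

(** The codeword of (a, b, c, h) is the vector of values of Q(x) + Tr(c x) + h, where
    Q = Q_(a,b) is the quadratic form Tr(a x^(p^l+1) + b x^2). Its radical consists
    of roots of a linearized polynomial of p^l-degree 2, so for (a, b) <> 0 it has
    order rho = 1, p or p^2, as gcd(l, m) = 1. Counting the solutions of
    Q(x) = Q(y) and the parity of the fibers of Q give p u^2 + v^2 = p^(m-1) rho,
    where u and v are half the sum and half the difference of the deviations from
    p^(m-1) of the fiber sizes at 1 and at a nonsquare. A descent forces u = 0 (odd
    rank) or v = 0 (even rank), so the fibers of Q are known up to one sign.
    Summing the numbers of zeros of Q(x), Q(x) - Q(y), Q(x) - s Q(y) (s a nonsquare)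
    and Q(x) - Q(y) - Q(z) over all (a, b) gives linear equations that determine how
    many (a, b) there are of each corank and sign. Finally, Tr(c x) is either
    nontrivial on the radical, which makes Q(x) + Tr(c x) + h equidistributed, or
    polar to some x0, and then translation by x0 reduces it to a fiber of Q. *)

(** * Fiber counts, additive characters and squares over the prime field *)

Lemma leq_card_fibers (T U : finType) (A : {set T}) (g : T -> U) k :
  (forall x, x \in A -> #|[set y in A | g y == g x]| <= k) ->
  #|A| <= #|g @: A| * k.
Proof.
move=> le_k; rewrite -sum1_card (partition_big g (mem (g @: A))) /=; last first.
  by move=> x Ax; apply: imset_f.
rewrite -sum_nat_const; apply: leq_sum => _ /imsetP[x Ax ->].
rewrite sum1_card; apply: leq_trans (le_k x Ax).
by apply/subset_leq_card/subsetP=> y; rewrite !inE.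
Qed.

Section PrimeField.

Import GRing.Theory Num.Theory Order.TTheory.
Local Open Scope ring_scope.

Variables (p : nat) (p_pr : prime p).

(* The sum of psi t over the nontrivial additive characters psi of 'F_p. *)
Definition zker (t : 'F_p) : int := p%:Z *+ (t == 0) - 1.

Lemma zker0 : zker 0 = p%:Z - 1.
Proof. by rewrite /zker eqxx. Qed.

Lemma zker_neq0 t : t != 0 -> zker t = -1.
Proof. by rewrite /zker => /negPf ->; rewrite sub0r. Qed.

Lemma zkerM s t : s != 0 -> zker (s * t) = zker t.
Proof. by rewrite /zker mulf_eq0 => /negPf ->. Qed.

Lemma zkerN t : zker (- t) = zker t.
Proof. by rewrite /zker oppr_eq0. Qed.

Lemma sum_zker (N : 'F_p -> int) u :
  \sum_t N t * zker (t - u) = p%:Z * N u - \sum_t N t.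
Proof.
rewrite (bigD1 u) //= subrr zker0 [in RHS](bigD1 u) //=.
under eq_bigr => t tu do rewrite zker_neq0 ?subr_eq0 // mulrN1.
by rewrite sumrN; ring.
Qed.

Lemma zker_sum0 : \sum_t zker t = 0.
Proof.
have := sum_zker (fun=> 1) 0.
under eq_bigr => t _ do rewrite mul1r subr0.
by move=> ->; rewrite sumr_const card_Fp // mulr1 natz subrr.
Qed.

Lemma sum_fibers (T : finType) (g : T -> 'F_p) (h : 'F_p -> int) :
  \sum_x h (g x) = \sum_t #|[set x | g x == t]|%:Z * h t.
Proof.
rewrite (partition_big g predT) //=; apply: eq_bigr => t _.
rewrite (eq_bigr (fun=> h t)) => [|x /eqP -> //].
rewrite sumr_const -mulr_natl natz; congr (Posz _ * _).
by apply: eq_card => x; rewrite inE.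
Qed.

Section Translate.

Variables (V : finZmodType) (A : {set V}) (g : V -> 'F_p) (u : V) (d : 'F_p).
Hypothesis Au : forall x, x \in A -> x + u \in A.
Hypothesis gu : forall x, x \in A -> g (x + u) = g x + d.
Hypothesis d_neq0 : d != 0.

(** Translation by [u] embeds the fiber at s into the fiber at s + d. As d generates the additive
    group of ['F_p], the sizes increase around a cycle, hence are all equal. *)
Lemma translate_fiber t : (p * #|[set x in A | g x == t]|)%N = #|A|.
Proof.
pose c (t : 'F_p) := #|[set x in A | g x == t]|.
have cS s : (c s <= c (s + d)%R)%N.
  rewrite /c -(card_imset _ (addIr u)); apply/subset_leq_card/subsetP => y.
  case/imsetP=> x; rewrite !inE => /andP[Ax /eqP gx] ->.
  by rewrite Au ?gu // gx eqxx.
have cD s k : (c s <= c (s + d *+ k)%R)%N.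
  elim: k => [|k IHk]; first by rewrite mulr0n addr0.
  by apply: leq_trans IHk _; rewrite mulrSr addrA.
have c_le s s' : (c s <= c s')%N.
  have := cD s ((s' - s) / d : 'F_p).
  by rewrite -mulr_natr natr_Zp [d * _]mulrC divfK // addrC subrK.
rewrite -[RHS]sum1_card [RHS](partition_big g predT) //=.
rewrite (eq_bigr (fun=> c t)) => [|s _].
  by rewrite sum_nat_const card_Fp.
rewrite sum1_card -[LHS](_ : c s = _); last first.
  by apply: eq_card => x; rewrite !inE.
by apply/eqP; rewrite eqn_leq !c_le.
Qed.

Lemma translate_zker t : \sum_(x in A) zker (g x - t) = 0.
Proof.
rewrite /zker big_split /= sumrN sumr_const -(translate_fiber t) sumrMnr.
suff -> : (\sum_(x in A) (g x - t == 0)%R = #|[set x in A | g x == t]|)%N.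
  by rewrite -[p%:Z]natz -mulrnA subrr.
rewrite -sum1_card [RHS]big_mkcond [LHS]big_mkcond /=; apply: eq_bigr => x _.
by rewrite inE subr_eq0; case: (x \in A); case: eqP.
Qed.

End Translate.

(** On a finite set a surjective squaring map would be injective, but it identifies 1 and -1, which
    differ for odd [p]. *)
Lemma ex_nonsquare : odd p -> exists s : 'F_p, forall x : 'F_p, x ^+ 2 != s.
Proof.
move=> p_odd.
case: (pickP (fun s : 'F_p => [forall x : 'F_p, x ^+ 2 != s])) => [s /forallP|no_s].
  by exists s.
pose sq (x : 'F_p) := x ^+ 2.
have sq_surj : codom sq =i predT.
  move=> s; have/negbT := no_s s; rewrite negb_forall => /existsP[x].
  by rewrite negbK => /eqP <-; rewrite (codom_f sq).
have sq_inj : {in 'F_p &, injective sq}.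
  by apply/image_injP; rewrite (eq_card sq_surj).
have /eqP := sq_inj 1 (-1) isT isT (esym (sqrrN 1)).
rewrite -subr_eq0 opprK -[1 + 1]/(2%:R) -(dvdn_pcharf (pchar_Fp p_pr)).
by rewrite dvdn_prime2 // => /eqP p2; rewrite p2 in p_odd.
Qed.

(** Squaring is at most two-to-one, so the nonzero squares [S] are at least half of the units; [S']
    = s S is disjoint from [S] and equally large, so the two cover all units. *)
Lemma square_classes (s t : 'F_p) : (forall x : 'F_p, x ^+ 2 != s) -> t != 0 ->
  exists2 x, x != 0 & t = x ^+ 2 \/ t = s * x ^+ 2.
Proof.
move=> s_nsq t_neq0.
have s_neq0 : s != 0 by have := s_nsq 0; rewrite expr0n eq_sym.
pose A := [set x : 'F_p | x != 0]; pose S := [set x ^+ 2 | x in A].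
pose S' := [set s * x | x in S].
have cardA : #|A| = p.-1.
  rewrite (_ : A = [set~ 0]); last by apply/setP=> x; rewrite !inE.
  by rewrite cardsC1 card_Fp.
have le_A : (#|A| <= #|S| * 2)%N.
  apply: leq_card_fibers => x _; apply: leq_trans (_ : #|[set x; - x]| <= 2)%N; last first.
    by rewrite cards2; case: (_ == _).
  by apply/subset_leq_card/subsetP=> z; rewrite !inE eqf_sqr => /andP[].
have cardS' : #|S'| = #|S| by apply: card_imset; apply: mulfI.
have dis : [disjoint S & S'].
  rewrite -setI_eq0; apply/eqP/setP=> y; rewrite !inE; apply/negP=> /andP[].
  case/imsetP=> x _ -> /imsetP[v /imsetP[z]]; rewrite inE => nz_z -> xz.
  have := s_nsq (x / z); rewrite expr_div_n xz mulfK ?eqxx //.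
  by rewrite expf_neq0.
have : t \in S :|: S'.
  suff /eqP -> : S :|: S' == A by rewrite inE.
  rewrite eqEcard; apply/andP; split; last first.
    by rewrite cardsU disjoint_setI0 // cards0 subn0 cardS' addnn -muln2.
  apply/subsetP=> y; rewrite !inE => /orP[] /imsetP[x].
    by rewrite inE => nz_x ->; rewrite expf_neq0.
  by case/imsetP=> z; rewrite inE => nz_z -> ->; rewrite mulf_neq0 ?expf_neq0.
rewrite inE => /orP[] /imsetP[x].
  by rewrite inE => nz_x tE; exists x; auto.
by case/imsetP=> z; rewrite inE => nz_z -> tE; exists z; auto.
Qed.

Lemma dvd_sqr (z : int) : (p %| z ^+ 2)%Z -> exists w, z = p%:Z * w.
Proof.
rewrite dvdzE abszX Euclid_dvdX //= andbT -[p]/(`|p%:Z|%N) -dvdzE.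
by case/dvdzP=> w ->; exists w; rewrite mulrC.
Qed.

(** Descent: p divides y, then x, and dividing by p^2 lowers k. For k = 0 the coefficient p > 1
    forces x = 0. *)
Lemma square_descent k (x y : int) :
  p%:Z * x ^+ 2 + y ^+ 2 = (p ^ (2 * k))%N%:Z -> x = 0 /\ y ^+ 2 = (p ^ (2 * k))%N%:Z.
Proof.
have p_gt1 := prime_gt1 p_pr.
elim: k x y => [|k IHk] x y.
  move=> E; have x0 : x = 0 by nia.
  by split=> //; rewrite -E x0; ring.
rewrite mulnS expnD PoszM => E.
have [z yE] : exists w, y = p%:Z * w.
  apply: dvd_sqr; apply/dvdzP; exists (p%:Z * (p ^ (2 * k))%N%:Z - x ^+ 2).
  have -> : y ^+ 2 = (p ^ 2)%N%:Z * (p ^ (2 * k))%N%:Z - p%:Z * x ^+ 2.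
    by rewrite -E; ring.
  by rewrite -mulnn PoszM; ring.
have p_neq0 : p%:Z != 0 by lia.
have [w xE] : exists w, x = p%:Z * w.
  apply: dvd_sqr; apply/dvdzP; exists ((p ^ (2 * k))%N%:Z - z ^+ 2).
  apply: (mulfI p_neq0); move: E; rewrite yE -mulnn PoszM => E.
  have -> : p%:Z * x ^+ 2 = p%:Z * p%:Z * (p ^ (2 * k))%N%:Z - (p%:Z * z) ^+ 2.
    by rewrite -E; ring.
  by ring.
have [] := IHk w z.
  apply: (mulfI p_neq0); apply: (mulfI p_neq0).
  move: E; rewrite xE yE -mulnn PoszM => E.
  by rewrite [in RHS]mulrA -E; ring.
by move=> w0 zE; rewrite xE yE w0 mulr0 exprMn zE -mulnn PoszM.
Qed.

End PrimeField.

(** * Fibers of a quadratic map on an elementary abelian p-group *)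

Lemma even_card_involution (T : finType) (g : T -> T) (A : {set T}) :
  involutive g -> (forall x, x \in A -> g x \in A) ->
  (forall x, x \in A -> g x != x) -> ~~ odd #|A|.
Proof.
move=> gK; have [n] := ubnP #|A|; elim: n A => // n IHn A lt_n gA g_neq.
case: (set_0Vmem A) => [->|[x Ax]]; first by rewrite cards0.
pose B := A :\ x :\ g x.
have cardA : #|A| = #|B|.+2.
  by rewrite (cardsD1 x) Ax (cardsD1 (g x) (A :\ x)) !inE g_neq ?gA.
rewrite cardA /= negbK; apply: IHn.
- by rewrite cardA in lt_n; lia.
- move=> y; rewrite !inE (can_eq gK) => /and3P[ygx yx Ay].
  by rewrite yx gA // andbT; apply: contra ygx => /eqP <-; rewrite gK.
- by move=> y; rewrite !inE => /and3P[_ _]; apply: g_neq.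
Qed.

Section QuadraticMap.

Import GRing.Theory Num.Theory Order.TTheory.
Local Open Scope ring_scope.

Variables (p : nat) (p_pr : prime p) (p_odd : odd p) (V : finZmodType).
Variable Q : V -> 'F_p.

Definition polar x y := Q (x + y) - Q x - Q y.

Definition radical := [set u | [forall v, polar u v == 0]].

(** Under [cardV], [C] is the mean size of a fiber of [Q]. *)
Definition excess (C : nat) (t : 'F_p) : int := #|[set x | Q x == t]|%:Z - C%:Z.

Hypothesis pV : forall v : V, v *+ p = 0.
Hypothesis polarDr : forall x y z, polar x (y + z) = polar x y + polar x z.
Hypothesis quadN : forall x, Q (- x) = Q x.
Variable C : nat.
Hypothesis cardV : #|V| = (p * C)%N.

Notation f := (excess C).
Notation rho := #|radical|.

Lemma quadD x y : Q (x + y) = Q x + Q y + polar x y.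
Proof. by rewrite /polar; ring. Qed.

Lemma polarC x y : polar x y = polar y x.
Proof. by rewrite /polar (addrC x y); ring. Qed.

Lemma polar0r x : polar x 0 = 0.
Proof. by apply: (addrI (polar x 0)); rewrite -polarDr !addr0. Qed.

Lemma quad0 : Q 0 = 0.
Proof.
have := polar0r 0; rewrite /polar addr0 subrr sub0r => /eqP.
by rewrite oppr_eq0 => /eqP.
Qed.

Lemma polarNr x y : polar x (- y) = - polar x y.
Proof. by apply: (addrI (polar x y)); rewrite -polarDr !subrr polar0r. Qed.

(** Evenness enters here: it makes [polar x (- x)] equal to - 2 Q(x). With additivity it yields the
    homogeneity [quadMn]. *)
Lemma polarxx x : polar x x = Q x *+ 2.
Proof.
by rewrite -[LHS]opprK -polarNr /polar subrr quad0 quadN; ring.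
Qed.

Lemma polarMnr x y n : polar x (y *+ n) = polar x y *+ n.
Proof.
elim: n => [|n IHn]; first exact: polar0r.
by rewrite !mulrSr polarDr IHn.
Qed.

Lemma quadMn x n : Q (x *+ n) = n%:R ^+ 2 * Q x.
Proof.
elim: n => [|n IHn]; first by rewrite quad0 expr0n mul0r.
by rewrite mulrS quadD IHn polarMnr polarxx mulrS; ring.
Qed.

Lemma radicalP u : reflect (forall v, polar u v = 0) (u \in radical).
Proof. by rewrite inE; apply: (iffP forallP) => R_u v; apply/eqP; apply: R_u. Qed.

Lemma quad_radical u : u \in radical -> Q u = 0.
Proof.
move/radicalP/(_ u)/eqP; rewrite polarxx -mulr_natl mulf_eq0.
rewrite -(dvdn_pcharf (pchar_Fp p_pr)) dvdn_prime2 //.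
have /negPf -> : p != 2%N by apply: contraL p_odd => /eqP ->.
by move/eqP.
Qed.

Lemma card_radical_dvd : (rho %| #|V|)%N.
Proof.
have gR : group_set radical.
  apply/group_setP; split=> [|x y /radicalP Rx /radicalP Ry].
    by apply/radicalP=> v; rewrite polarC polar0r.
  by apply/radicalP=> v; rewrite polarC polarDr !(polarC v) Rx Ry addr0.
by rewrite -cardsT; apply: (@cardSg _ [group of [set: V]] (Group gR)); apply: subsetT.
Qed.

Lemma sum_card_fibers : \sum_t #|[set x | Q x == t]|%:Z = (p * C)%N%:Z.
Proof.
have := sum_fibers Q (fun=> 1); rewrite sumr_const cardV natz => ->.
by apply: eq_bigr => t _; rewrite mulr1.
Qed.

Lemma sum_excess : \sum_t f t = 0.
Proof.
rewrite /excess big_split /= sum_card_fibers sumr_const card_Fp //.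
by rewrite PoszM -mulr_natl natz; ring.
Qed.

Lemma sum_quad_zker u : \sum_x zker (Q x - u) = p%:Z * f u.
Proof.
rewrite (sum_fibers Q (fun t => zker (t - u))) sum_zker sum_card_fibers.
by rewrite /excess PoszM; ring.
Qed.

Lemma sum_quad_excess (g : 'F_p -> int) :
  \sum_t g t = 0 -> \sum_x g (Q x) = \sum_t f t * g t.
Proof.
move=> g0; rewrite sum_fibers /excess.
under [in RHS]eq_bigr do rewrite mulrBl.
by rewrite big_split /= sumrN -mulr_sumr g0 mulr0 subr0.
Qed.

(** Put x = y + z. Then Q(x) - Q(y) = Q(z) + polar(z, y): for z in the radical this is 0 for all y,
    and for any other z it is equidistributed in y, so that its [zker] sums to 0. *)
Lemma sum_quadB_zker :
  \sum_x \sum_y zker (Q x - Q y) = (p%:Z - 1) * (p * C)%N%:Z * rho%:Z.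
Proof.
rewrite exchange_big /=.
under eq_bigr => y _ do rewrite (reindex_inj (addrI y)) /=.
rewrite exchange_big /= (bigID (mem radical)) /= [X in _ + X]big1 ?addr0.
  rewrite (eq_bigr (fun=> (p%:Z - 1) * (p * C)%N%:Z)) => [|z /[dup] Rz /radicalP pz].
    by rewrite sumr_const -mulr_natr natz.
  rewrite (eq_bigr (fun=> p%:Z - 1)) => [|y _].
    by rewrite sumr_const cardV -mulr_natr natz.
  by rewrite quadD polarC pz (quad_radical Rz) !addr0 subrr zker0.
move=> z; rewrite inE negb_forall => /existsP[u nz_u].
transitivity (\sum_(y in [set: V]) zker (polar z y - - Q z)).
  apply: eq_big => [y|y _]; first by rewrite inE.
  by rewrite quadD polarC; congr zker; ring.
by apply: (translate_zker p_pr _ _ nz_u) => x _; rewrite ?inE ?polarDr.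
Qed.

(** The double sum of [sum_quadB_zker] can also be evaluated fiberwise: summing over one variable
    gives p f, and then over the other p times the sum of f^2. *)
Lemma sum_sqr_excess : \sum_t f t ^+ 2 = (p%:Z - 1) * C%:Z * rho%:Z.
Proof.
have p_neq0 : p%:Z != 0 by have := prime_gt0 p_pr; lia.
apply: (mulfI p_neq0).
transitivity ((p%:Z - 1) * (p * C)%N%:Z * rho%:Z); last by rewrite PoszM; ring.
rewrite -sum_quadB_zker exchange_big /=.
under [RHS]eq_bigr do rewrite sum_quad_zker.
by rewrite -mulr_sumr sum_quad_excess ?sum_excess.
Qed.

Lemma mulrn_eqmod (v : V) m n : m = n %[mod p] -> v *+ m = v *+ n.
Proof.
move=> mn; rewrite (divn_eq m p) (divn_eq n p) mn !mulrnDr !(mulnC _ p).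
by rewrite !mulrnA pV !mul0rn.
Qed.

Lemma mulrn_Fp_inj (x : 'F_p) : x != 0 -> injective (fun v : V => v *+ x).
Proof.
move=> nz_x; apply: (can_inj (g := fun v => v *+ (x^-1 : 'F_p))) => v.
rewrite -mulrnA -[RHS]mulr1n; apply: mulrn_eqmod.
by rewrite -!val_Fp_nat // natrM !natr_Zp mulfV.
Qed.

(** Multiplication by [x] is injective on [V] and carries the fiber at t into the fiber at x^2 t;
    the inverse of [x] gives the reverse inequality. *)
Lemma excess_square (x t : 'F_p) : x != 0 -> f (x ^+ 2 * t) = f t.
Proof.
have le_card (y s : 'F_p) : y != 0 ->
    (#|[set v | Q v == s]| <= #|[set v | (Q v == y ^+ 2 * s)%R]|)%N.
  move=> nz_y; rewrite -(card_imset _ (mulrn_Fp_inj nz_y)).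
  apply/subset_leq_card/subsetP=> w /imsetP[v]; rewrite inE => /eqP <- ->.
  by rewrite inE quadMn natr_Zp.
move=> nz_x; congr (Posz _ - _); apply/eqP; rewrite eqn_leq le_card // andbT.
have := le_card x^-1 (x ^+ 2 * t); rewrite invr_eq0 => /(_ nz_x).
by rewrite mulrA -exprMn mulVf // expr1n mul1r.
Qed.

(** Negation acts on the fiber; its only fixed point in [V] is 0, as p is odd, and Q(0) = 0. *)
Lemma even_card_fiber t : t != 0 -> ~~ odd #|[set x | Q x == t]|.
Proof.
move=> nz_t; apply: (@even_card_involution _ -%R); first exact: opprK.
  by move=> x; rewrite !inE quadN.
move=> x; rewrite inE => /eqP Qx; apply: contra nz_t => /eqP Nx.
suff x0 : x = 0 by rewrite -Qx x0 quad0.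
have x2 : x *+ 2 = 0 by rewrite mulr2n -{1}Nx addNr.
by rewrite -(pV x) -[p]odd_double_half p_odd mulrnDr -mul2n mulrnA x2 mul0rn addr0.
Qed.

Section SquareClasses.

Variable s : 'F_p.
Hypothesis s_nsq : forall x : 'F_p, x ^+ 2 != s.

Let s_neq0 : s != 0.
Proof. by have := s_nsq 0; rewrite expr0n eq_sym. Qed.

Lemma excess_class t : t != 0 ->
  (f t = f 1 /\ f (s * t) = f s) \/ (f t = f s /\ f (s * t) = f 1).
Proof.
move=> nz_t; have [x nz_x [->|->]] := square_classes p_pr s_nsq nz_t.
  by left; rewrite [s * _]mulrC -{1}[x ^+ 2]mulr1 !excess_square.
right; rewrite [s * x ^+ 2]mulrC excess_square // mulrCA excess_square //.
by rewrite -[s * s]mulr1 -expr2 excess_square.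
Qed.

(** For nonzero t, the elements t and s t lie in opposite square classes. Adding the sum over t to
    its reindexing by s t makes every nonzero term equal, hence the doubling. *)
Lemma sum_excess_classes (phi : int -> int) :
  (\sum_t phi (f t)) *+ 2 = phi (f 0) *+ 2 + (p%:Z - 1) * (phi (f 1) + phi (f s)).
Proof.
rewrite (bigD1 0) //= mulrnDl; congr (_ + _); rewrite mulr2n.
rewrite {2}(reindex_inj (mulfI s_neq0)) /=.
rewrite [X in _ + X](eq_bigl (fun t => t != 0)); last first.
  by move=> t; rewrite mulf_eq0 (negPf s_neq0).
rewrite -big_split /= (eq_bigr (fun=> phi (f 1) + phi (f s))) => [|t nz_t].
  rewrite sumr_const -[LHS]mulr_natl; congr (_ * _).
  rewrite (eq_card (B := predC1 0)) // cardC1 card_Fp // natz.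
  by have := prime_gt0 p_pr; lia.
by case: (excess_class nz_t) => [] [-> ->] //; rewrite addrC.
Qed.

(* The last two equations are the first two moments of [f], which is constant on
   the square classes; [a] and [b] are integers since the fibers are even. *)
Lemma excess_pell : exists a b : int, [/\ f 1 = a + b, f s = a - b,
  f 0 = - (p%:Z - 1) * a & p%:Z * a ^+ 2 + b ^+ 2 = (C * rho)%N%:Z].
Proof.
have p_gt1 := prime_gt1 p_pr.
have e1 := even_card_fiber (oner_neq0 'F_p); have es := even_card_fiber s_neq0.
have [a aE] : exists a : int, f 1 + f s = a *+ 2.
  exists (#|[set x | Q x == 1%R]|./2%:Z + #|[set x | Q x == s]|./2%:Z - C%:Z).
  by rewrite /excess; lia.
have := sum_excess_classes id; rewrite sum_excess aE mul0rn => E1.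
have f0 : f 0 = - (p%:Z - 1) * a by lia.
exists a, (f 1 - a); split; [ring| |exact: f0|].
  by rewrite -[LHS](addKr (f 1)) aE; ring.
have := sum_excess_classes (fun z => z ^+ 2); rewrite sum_sqr_excess f0.
have -> : f s = a *+ 2 - f 1 by rewrite -aE; ring.
move=> E2; have p1_neq0 : (p%:Z - 1) *+ 2 != 0 by lia.
apply: (mulfI p1_neq0); move: E2; rewrite PoszM => E2.
transitivity (((p%:Z - 1) * C%:Z * rho%:Z) *+ 2); last by ring.
by rewrite E2; ring.
Qed.

End SquareClasses.

(** Even rank. In the equation p a^2 + b^2 = p^(2k+1) of [excess_pell], p divides b; writing b = p c
    and dividing by p gives p c^2 + a^2 = p^(2k), so the descent yields c = 0. The a found here is
    the [b] of the statement. *)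
Lemma excess_even k : (C * rho)%N = (p ^ (2 * k).+1)%N ->
  exists2 b : int, b ^+ 2 = (p ^ (2 * k))%N%:Z & forall t, f t = - b * zker t.
Proof.
have [s s_nsq] := ex_nonsquare p_pr p_odd.
have [a [b [f1 fs f0]]] := excess_pell s_nsq.
move=> + Crho; rewrite Crho expnS PoszM => E.
have p_neq0 : p%:Z != 0 by have := prime_gt0 p_pr; lia.
have [c bE] : exists c, b = p%:Z * c.
  apply: (dvd_sqr p_pr); apply/dvdzP; exists ((p ^ (2 * k))%N%:Z - a ^+ 2).
  by rewrite mulrBl -[_ * p%:Z]mulrC -E; ring.
have [c0 aE] : c = 0 /\ a ^+ 2 = (p ^ (2 * k))%N%:Z.
  apply: (square_descent p_pr); apply: (mulfI p_neq0); rewrite -E bE; ring.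
exists a => // t; have [->|nz_t] := eqVneq t 0; first by rewrite f0 zker0; ring.
rewrite zker_neq0 // mulrN1 opprK.
by case: (excess_class s_nsq nz_t) => [] [-> _]; rewrite ?f1 ?fs bE c0; ring.
Qed.

(** Odd rank. The descent gives a = 0, so [f] is a multiple of the quadratic character, which is
    expressed by its square and its sign change under nonsquares. *)
Lemma excess_odd k : (C * rho)%N = (p ^ (2 * k))%N ->
  [/\ f 0 = 0, forall t, t != 0 -> f t ^+ 2 = (p ^ (2 * k))%N%:Z &
      forall s t, (forall x : 'F_p, x ^+ 2 != s) -> f (s * t) = - f t].
Proof.
move=> Crho.
have main s : (forall x : 'F_p, x ^+ 2 != s) ->
    [/\ f 0 = 0, f 1 ^+ 2 = (p ^ (2 * k))%N%:Z & f s = - f 1].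
  move=> s_nsq; have [a [b [f1 fs f0]]] := excess_pell s_nsq.
  rewrite Crho => /(square_descent p_pr)[a0 bE].
  by rewrite f0 f1 fs a0; split; rewrite ?add0r //; ring.
have [s s_nsq] := ex_nonsquare p_pr p_odd.
have [f0 f1 fs] := main s s_nsq; split=> // [t nz_t|r t r_nsq].
  by case: (excess_class s_nsq nz_t) => [] [-> _]; rewrite ?fs ?sqrrN.
have [_ _ fr] := main r r_nsq.
have [->|nz_t] := eqVneq t 0; first by rewrite mulr0 f0 oppr0.
by case: (excess_class r_nsq nz_t) => [] [-> ->]; rewrite fr ?opprK.
Qed.

(** If [V] has order p^n and the radical order p^r, then e = n - 1 + r, which is odd exactly when
    the rank n - r is even. *)
Lemma excess_parity e : (C * rho)%N = (p ^ e)%N ->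
  if odd e then exists2 b : int, b ^+ 2 = (p ^ (e.-1))%N%:Z & forall t, f t = - b * zker t
  else [/\ f 0 = 0, forall t, t != 0 -> f t ^+ 2 = (p ^ e)%N%:Z &
      forall s t, (forall x : 'F_p, x ^+ 2 != s) -> f (s * t) = - f t].
Proof.
move=> Crho; case: ifP => e_odd.
  have [k eE] : exists k, e = (2 * k).+1.
    by exists e./2; rewrite -[LHS]odd_double_half e_odd mul2n.
  by subst e; apply: (excess_even Crho).
have [k eE] : exists k, e = (2 * k)%N.
  by exists e./2; rewrite -[LHS]odd_double_half e_odd mul2n.
by subst e; apply: (excess_odd Crho).
Qed.

(** Evaluated fiberwise, the sum is p times the sum of f(t) f(s t), and f(s t) is f(t) for even rank
    and - f(t) for odd rank. The sign thus detects the parity of the rank. *)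
Lemma sum_quad_nonsquare_zker e s : (C * rho)%N = (p ^ e)%N ->
    (forall x : 'F_p, x ^+ 2 != s) ->
  \sum_x \sum_y zker (Q x - s * Q y) =
    (-1) ^+ (~~ odd e) * ((p%:Z - 1) * (p * C)%N%:Z * rho%:Z).
Proof.
move=> Crho s_nsq.
have s_neq0 : s != 0 by have := s_nsq 0; rewrite expr0n eq_sym.
rewrite exchange_big /=; under eq_bigr do rewrite sum_quad_zker.
rewrite -mulr_sumr (sum_quad_excess (g := fun t => f (s * t))); last first.
  by have := sum_excess; rewrite (reindex_inj (mulfI s_neq0)).
have -> : \sum_t f t * f (s * t) = (-1) ^+ (~~ odd e) * \sum_t f t ^+ 2.
  rewrite mulr_sumr; apply: eq_bigr => t _.
  case: (odd e) (excess_parity Crho) => [[b _ fE]|[_ _ ->]] //=.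
    by rewrite !fE zkerM //; ring.
  by ring.
by rewrite sum_sqr_excess PoszM; ring.
Qed.

(** The triple sum is p times the sum of f(u) f(v) f(u + v). For even rank [f] is a multiple of
    [zker], whose convolution with itself is p times [zker]. For odd rank, scaling u and v by a
    nonsquare changes the sign of all three factors, so the sum is 0, and so is f(0). *)
Lemma sum_quad3_zker e : (C * rho)%N = (p ^ e)%N ->
  \sum_x \sum_y \sum_z zker (Q x - (Q y + Q z)) =
    p%:Z * f 0 * ((p * C)%N%:Z * rho%:Z).
Proof.
move=> Crho.
have shift (u : 'F_p) : \sum_t f (u + t) = 0.
  by have := sum_excess; rewrite (reindex_inj (addrI u)).
transitivity (p%:Z * \sum_u \sum_v f u * (f v * f (u + v))).
  rewrite exchange_big /=; under eq_bigr => y _ do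
    [rewrite exchange_big /=; under eq_bigr do rewrite sum_quad_zker].
  under eq_bigr => y _ do rewrite -mulr_sumr (sum_quad_excess (shift _)).
  rewrite -mulr_sumr (sum_quad_excess (g := fun u => \sum_v f v * f (u + v))).
    by congr (_ * _); apply: eq_bigr => u _; rewrite mulr_sumr.
  rewrite exchange_big /= big1 // => v _; rewrite -mulr_sumr.
  by under eq_bigr do rewrite addrC; rewrite shift mulr0.
move: (excess_parity Crho); case: ifP => [e_odd [b b2 fE]|_ [f0 _ fs]].
  have zz (u : 'F_p) : \sum_v f v * f (u + v) = b ^+ 2 * (p%:Z * zker u).
    transitivity (b ^+ 2 * \sum_v zker v * zker (v - - u)).
      rewrite mulr_sumr; apply: eq_bigr => v _.
      by rewrite !fE opprK [v + u]addrC; ring.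
    by rewrite sum_zker zker_sum0 // zkerN subr0.
  under eq_bigr => u _ do rewrite -mulr_sumr zz fE.
  transitivity (p%:Z * (- b * b ^+ 2 * p%:Z * \sum_(u : 'F_p) zker u * zker (u - 0))).
    by congr (_ * _); rewrite mulr_sumr; apply: eq_bigr => u _; rewrite subr0; ring.
  have Crho' : C%:Z * rho%:Z = p%:Z * b ^+ 2.
    by rewrite b2 -!PoszM Crho -expnS prednK // odd_gt0.
  rewrite sum_zker zker_sum0 // fE zker0 PoszM.
  transitivity (p%:Z ^+ 2 * (- b) * (p%:Z - 1) * (C%:Z * rho%:Z)); last by ring.
  by rewrite Crho'; ring.
have [s s_nsq] := ex_nonsquare p_pr p_odd.
have s_neq0 : s != 0 by have := s_nsq 0; rewrite expr0n eq_sym.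
set S := \sum_u _; have : S = - S.
  rewrite {1}/S (reindex_inj (mulfI s_neq0)) /S -sumrN; apply: eq_bigr => u _ /=.
  rewrite (reindex_inj (mulfI s_neq0)) -sumrN; apply: eq_bigr => v _ /=.
  by rewrite -mulrDr !fs //; ring.
move=> S0; have -> : S = 0 by lia.
by rewrite f0; ring.
Qed.

Lemma sum_excess_even (phi : int -> rat) b : (forall t, f t = - b * zker t) ->
  \sum_t phi (f t) = phi (- b * (p%:Z - 1)) + (p%:R - 1) * phi b.
Proof.
move=> fE; rewrite (bigD1 0) //= fE zker0; congr (_ + _).
rewrite (eq_bigr (fun=> phi b)) => [|t nz_t].
  rewrite sumr_const -[LHS]mulr_natl; congr (_ * _).
  by rewrite (eq_card (B := predC1 0)) // cardC1 card_Fp // -subn1 natrB ?prime_gt0.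
by rewrite fE zker_neq0 // mulrN1 opprK.
Qed.

(** For nonzero t and a nonsquare s, the values f(t) and f(s t) are d and - d in some order. *)
Lemma sum_excess_odd (phi : int -> rat) d : f 0 = 0 ->
    (forall t, t != 0 -> f t ^+ 2 = d ^+ 2) ->
    (forall s t, (forall x : 'F_p, x ^+ 2 != s) -> f (s * t) = - f t) ->
  \sum_t phi (f t) = phi 0 + (p%:R - 1) / 2 * (phi d + phi (- d)).
Proof.
move=> f0 f2 fs; rewrite (bigD1 0) //= f0; congr (_ + _).
have [s s_nsq] := ex_nonsquare p_pr p_odd.
have s_neq0 : s != 0 by have := s_nsq 0; rewrite expr0n eq_sym.
set S := LHS; have S2 : S + S = (p%:R - 1) * (phi d + phi (- d)).
  rewrite {2}/S (reindex_inj (mulfI s_neq0)) /=.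
  rewrite [X in _ + X](eq_bigl (fun t => t != 0)); last first.
    by move=> t; rewrite mulf_eq0 (negPf s_neq0).
  rewrite -big_split /= (eq_bigr (fun=> phi d + phi (- d))) => [|t nz_t].
    rewrite sumr_const -[LHS]mulr_natl; congr (_ * _).
    by rewrite (eq_card (B := predC1 0)) // cardC1 card_Fp // -subn1 natrB ?prime_gt0.
  have /eqP := f2 t nz_t; rewrite eqf_sqr fs // => /orP[] /eqP ->; rewrite ?opprK //.
  exact: addrC.
lra.
Qed.

(** Translation by [u] leaves [Q] unchanged and shifts [lam] by a nonzero constant, so their sum is
    equidistributed. *)
Lemma card_zeros_affine_balanced (lam : V -> 'F_p) u h :
    {morph lam : x y / x + y} -> u \in radical -> lam u != 0 ->
  #|[set x | Q x + lam x + h == 0]| = C.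
Proof.
move=> lamD Ru nz_u.
have := @translate_fiber p p_pr V setT (fun x => Q x + lam x) u (lam u) _ _ nz_u (- h).
rewrite cardsT cardV => E; apply/eqP; rewrite -(eqn_pmul2l (prime_gt0 p_pr)).
rewrite -{}E => [|x|x _]; rewrite ?inE //; last first.
  rewrite lamD quadD (quad_radical Ru) polarC; move/radicalP: Ru => ->; ring.
by apply/eqP; congr (_ * _)%N; apply: eq_card => x; rewrite !inE -addr_eq0.
Qed.

(** Completing the square: Q(x) + polar(x0, x) = Q(x0 + x) - Q(x0). *)
Lemma card_zeros_affine_polar x0 h :
  #|[set x | Q x + polar x0 x + h == 0]| = #|[set x | Q x == Q x0 - h]|.
Proof.
rewrite -(card_imset _ (addrI x0)); apply: eq_card => y; rewrite !inE.
have QE x : (Q x + polar x0 x + h == 0) = (Q (x0 + x) == Q x0 - h).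
  by rewrite quadD -subr_eq0 -[in RHS]subr_eq0; congr (_ == 0); ring.
apply/imsetP/idP => [[x]|Qy]; first by rewrite inE QE => /eqP <- ->.
by exists (y - x0); rewrite ?inE ?QE addrC subrK.
Qed.


End QuadraticMap.

(** * Solving the moment equations and matching the tables *)

Section Tables.

Import GRing.Theory Num.Theory Order.TTheory.
Local Open Scope ring_scope.

Lemma sum_table (table : seq (rat * rat)) (x : rat) (I : rat -> rat) :
    (forall z, I z = (z == x)%:R) ->
  \sum_(r <- table | r.1 == x) r.2 = \sum_(r <- table) I r.1 * r.2.
Proof.
move=> IE; rewrite big_mkcond; apply: eq_bigr => r _.
by rewrite IE; case: eqP; rewrite ?mul1r ?mul0r.
Qed.

Variables (p j : nat) (p_gt1 : (1 < p)%N) (I : rat -> rat).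
Variables n0t n0f n1t n1f n2t n2f : rat.

Notation P := (p%:R : rat).
Notation y := (P ^+ j).

Let expE a c : P ^+ (a * j + c) = y ^+ a * P ^+ c.
Proof. by rewrite exprD mulnC exprM. Qed.

Let P_neq0 : P != 0.
Proof. by rewrite pnatr_eq0; case: p p_gt1. Qed.

Let y_neq0 : y != 0.
Proof. by rewrite expf_neq0 ?P_neq0. Qed.

Let P1_neq0 : P + 1 != 0.
Proof. by rewrite natr1 pnatr_eq0. Qed.

Let PB1_neq0 : P - 1 != 0.
Proof. by rewrite subr_eq0 (eqr_nat _ p 1) gtn_eqF. Qed.

Let P21_neq0 : P ^+ 2 - 1 != 0.
Proof. by rewrite subr_sqr_1 mulf_neq0 ?PB1_neq0 ?P1_neq0. Qed.

(** Here m = 2j + 3, q = p^m and D = q - p^(m-1); [n0t] to [n2f] stand for the numbers of nonzero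
    (a, b) of corank 0, 1, 2 with positive ([t]) or other ([f]) sign. Coranks 0 and 2 have odd rank,
    where only the sum over both signs enters, so four moment equations determine the four
    unknowns. *)
Lemma table_odd_sum (q := y ^+ 2 * P ^+ 3) (D := q - y ^+ 2 * P ^+ 2) :
    n0t + n0f + (n1t + n1f) + (n2t + n2f) = q ^+ 2 - 1 ->
    n1t * (P * (y * P * (P - 1))) + n1f * (P * (- (y * P) * (P - 1))) =
      (P - 1) * q * (q - 1) ->
    n0t + n0f + (n1t + n1f) * P + (n2t + n2f) * P ^+ 2 = 2 * q * (q - 1) ->
    - (n0t + n0f) + (n1t + n1f) * P - (n2t + n2f) * P ^+ 2 = 0 ->
  (q - 1) * P * I D + I 0 + (P - 1) * I q
  + (n0t + n0f) * (q * (I D + (P - 1) / 2 * (I (D - y * P) + I (D + y * P))))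
  + (n1t * ((q - q / P) * P * I D +
       q / P * (I (D - y * P * (P - 1)) + (P - 1) * I (D + y * P)))
     + n1f * ((q - q / P) * P * I D +
       q / P * (I (D + y * P * (P - 1)) + (P - 1) * I (D - y * P))))
  + (n2t + n2f) * ((q - q / P ^+ 2) * P * I D + q / P ^+ 2 *
       (I D + (P - 1) / 2 * (I (D - y * P ^+ 2) + I (D + y * P ^+ 2))))
  = \sum_(r <- table_odd p (2 * j + 3)) I r.1 * r.2.
Proof.
move=> E0 E1 E2 E2s.
(* [E2] plus [E2s] isolates corank 1. *)
have S1 : n1t + n1f = q * (q - 1) / P.
  apply: (mulIf P_neq0); rewrite divfK //; lra.
have D1 : n1t - n1f = y * P * (q - 1).
  have nz : P * (y * P) * (P - 1) != 0 by rewrite !mulf_neq0.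
  apply: (mulIf nz); transitivity ((P - 1) * q * (q - 1)); last by rewrite /q; ring.
  by rewrite -E1; ring.
(* Half of [E2] minus [E2s] weights corank 2 by P^2 and corank 0 by 1; [E0] and [S1] then remove
   corank 0. *)
have S2 : n2t + n2f = (q - 1) * (q / P - 1) / (P ^+ 2 - 1).
  apply: (mulIf P21_neq0); rewrite divfK //.
  transitivity (q * (q - 1) - (q ^+ 2 - 1 - q * (q - 1) / P)); last first.
    by field.
  rewrite -S1; lra.
have S0 : n0t + n0f = q * (q - 1) - P ^+ 2 * ((q - 1) * (q / P - 1) / (P ^+ 2 - 1)).
  by rewrite -S2; lra.
have n1tE : n1t = (q * (q - 1) / P + y * P * (q - 1)) / 2 by lra.
have n1fE : n1f = (q * (q - 1) / P - y * P * (q - 1)) / 2 by lra.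
rewrite S0 S2 n1tE n1fE {E0 E1 E2 E2s S1 D1 S2 S0 n1tE n1fE}.
rewrite /table_odd.
have -> : ((2 * j + 3 - 1) %/ 2 = 1 * j + 1)%N by lia.
have -> : ((2 * j + 3 - 3) %/ 2 = 1 * j + 0)%N by lia.
have -> : ((2 * j + 3 + 1) %/ 2 = 1 * j + 2)%N by lia.
have -> : ((3 * (2 * j + 3) - 3) %/ 2 = 3 * j + 3)%N by lia.
have -> : (2 * (2 * j + 3) - 1 = 4 * j + 5)%N by lia.
have -> : (2 * (2 * j + 3) - 2 = 4 * j + 4)%N by lia.
have -> : (2 * (2 * j + 3) - 3 = 4 * j + 3)%N by lia.
have -> : (2 * (2 * j + 3) - 4 = 4 * j + 2)%N by lia.
have -> : (2 * j + 3 - 1 = 2 * j + 2)%N by lia.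
have -> : (2 * j + 3 - 2 = 2 * j + 1)%N by lia.
have -> : (2 * j + 3 - 3 = 2 * j + 0)%N by lia.
have -> : (2 * j + 3 + 1 = 2 * j + 4)%N by lia.
have -> : (2 * j + 3 + 2 = 2 * j + 5)%N by lia.
rewrite !expE !big_cons big_nil /=.
have -> : y ^+ 2 * P ^+ 2 * (P - 1) = D by rewrite /D /q; ring.
have -> : y ^+ 1 * P ^+ 1 * (y ^+ 1 * P ^+ 2 - y ^+ 1 * P ^+ 1 - P + 1) =
  D - y * P * (P - 1) by rewrite /D /q; ring.
have -> : y ^+ 1 * P ^+ 1 * (y ^+ 1 * P ^+ 2 - y ^+ 1 * P ^+ 1 + P - 1) =
  D + y * P * (P - 1) by rewrite /D /q; ring.
have -> : y ^+ 1 * P ^+ 1 * (y ^+ 1 * P ^+ 2 - y ^+ 1 * P ^+ 1 + 1) = D + y * P.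
  by rewrite /D /q; ring.
have -> : y ^+ 1 * P ^+ 1 * (y ^+ 1 * P ^+ 2 - y ^+ 1 * P ^+ 1 - 1) = D - y * P.
  by rewrite /D /q; ring.
have -> : y ^+ 1 * P ^+ 2 * (y ^+ 1 * P ^+ 1 - y ^+ 1 * P ^+ 0 + 1) = D + y * P ^+ 2.
  by rewrite /D /q; ring.
have -> : y ^+ 1 * P ^+ 2 * (y ^+ 1 * P ^+ 1 - y ^+ 1 * P ^+ 0 - 1) = D - y * P ^+ 2.
  by rewrite /D /q; ring.
(* The values of [I], and then y, become free variables: the table agrees coefficient by
   coefficient, as an identity of rational functions in P and y. *)
rewrite -/q; move: (I 0) (I D) (I q) (I (D - y * P)) (I (D + y * P)).
move: (I (D - y * P * (P - 1))) (I (D + y * P * (P - 1))).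
move: (I (D - y * P ^+ 2)) (I (D + y * P ^+ 2)) => i1 i2 i3 i4 i5 i6 i7 i8 i9.
rewrite /q {D q}; move: y => Y; field.
by rewrite P_neq0 P1_neq0 P21_neq0.
Qed.

(** Here m = 2j + 4. Now coranks 0 and 2 have even rank and their signs count separately, so a fifth
    equation, the third moment, fixes the fifth unknown. *)
Lemma table_even_sum (q := y ^+ 2 * P ^+ 4) (D := q - y ^+ 2 * P ^+ 3) :
    n0t + n0f + (n1t + n1f) + (n2t + n2f) = q ^+ 2 - 1 ->
    n0t * (P * (y * P * (P - 1))) + n0f * (P * (- (y * P) * (P - 1))) +
      (n2t * (P * (y * P ^+ 2 * (P - 1))) + n2f * (P * (- (y * P ^+ 2) * (P - 1)))) =
      (P - 1) * q * (q - 1) ->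
    n0t + n0f + (n1t + n1f) * P + (n2t + n2f) * P ^+ 2 = 2 * q * (q - 1) ->
    n0t + n0f - (n1t + n1f) * P + (n2t + n2f) * P ^+ 2 = 0 ->
    n0t * (P * (y * P * (P - 1))) + n0f * (P * (- (y * P) * (P - 1))) +
      (n2t * (P * (y * P ^+ 2 * (P - 1)) * P ^+ 2) +
       n2f * (P * (- (y * P ^+ 2) * (P - 1)) * P ^+ 2)) =
      (P - 1) * q * P * (q - 1) ->
  (q - 1) * P * I D + I 0 + (P - 1) * I q
  + (n0t * (q * (I (D - y * P * (P - 1)) + (P - 1) * I (D + y * P)))
     + n0f * (q * (I (D + y * P * (P - 1)) + (P - 1) * I (D - y * P))))
  + (n1t + n1f) * ((q - q / P) * P * I D + q / P *
       (I D + (P - 1) / 2 * (I (D - y * P ^+ 2) + I (D + y * P ^+ 2))))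
  + (n2t * ((q - q / P ^+ 2) * P * I D + q / P ^+ 2 *
       (I (D - y * P ^+ 2 * (P - 1)) + (P - 1) * I (D + y * P ^+ 2)))
     + n2f * ((q - q / P ^+ 2) * P * I D + q / P ^+ 2 *
       (I (D + y * P ^+ 2 * (P - 1)) + (P - 1) * I (D - y * P ^+ 2))))
  = \sum_(r <- table_even p (2 * j + 4)) I r.1 * r.2.
Proof.
move=> E0 E1 E2 E2s E3.
have S1 : n1t + n1f = q * (q - 1) / P.
  apply: (mulIf P_neq0); rewrite divfK //; lra.
have S2 : n2t + n2f = (q - 1) * (q / P - 1) / (P ^+ 2 - 1).
  apply: (mulIf P21_neq0); rewrite divfK //.
  transitivity (q * (q - 1) - (q ^+ 2 - 1 - q * (q - 1) / P)); last by field.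
  rewrite -S1; lra.
have S0 : n0t + n0f = q * (q - 1) - P ^+ 2 * ((q - 1) * (q / P - 1) / (P ^+ 2 - 1)).
  by rewrite -S2; lra.
(* [E3] minus [E1] cancels corank 0; after that [E1] alone gives the difference in corank 0. *)
have D2 : n2t - n2f = y * P * (q - 1) / (P + 1).
  have nz : y * P ^+ 3 * (P - 1) * (P ^+ 2 - 1) != 0 by rewrite !mulf_neq0 ?expf_neq0.
  apply: (mulIf nz); transitivity ((P - 1) * q * P * (q - 1) - (P - 1) * q * (q - 1)).
    by rewrite -E1 -E3; ring.
  by rewrite /q; field.
have D0 : n0t - n0f = y * P ^+ 2 * (q - 1) - P * (y * P * (q - 1) / (P + 1)).
  have nz : y * P ^+ 2 * (P - 1) != 0 by rewrite !mulf_neq0 ?expf_neq0.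
  rewrite -D2; apply: (mulIf nz).
  transitivity ((P - 1) * q * (q - 1) - (n2t - n2f) * (y * P ^+ 3 * (P - 1))).
    by rewrite -E1; ring.
  by rewrite /q; ring.
pose A2 := (q - 1) * (q / P - 1) / (P ^+ 2 - 1); pose B2 := y * P * (q - 1) / (P + 1).
have n2tE : n2t = (A2 + B2) / 2 by rewrite /A2 /B2 -S2 -D2; field.
have n2fE : n2f = (A2 - B2) / 2 by rewrite /A2 /B2 -S2 -D2; field.
have n0tE : n0t = (q * (q - 1) - P ^+ 2 * A2 + (y * P ^+ 2 * (q - 1) - P * B2)) / 2.
  by rewrite /A2 /B2 -S0 -D0; field.
have n0fE : n0f = (q * (q - 1) - P ^+ 2 * A2 - (y * P ^+ 2 * (q - 1) - P * B2)) / 2.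
  by rewrite /A2 /B2 -S0 -D0; field.
rewrite S1 n0tE n0fE n2tE n2fE /A2 /B2.
rewrite {E0 E1 E2 E2s E3 S1 S2 S0 D2 D0 n0tE n0fE n2tE n2fE A2 B2} /table_even.
have -> : ((2 * j + 4) %/ 2 = 1 * j + 2)%N by lia.
have -> : ((2 * j + 4 - 2) %/ 2 = 1 * j + 1)%N by lia.
have -> : ((2 * j + 4 + 2) %/ 2 = 1 * j + 3)%N by lia.
have -> : (2 * (2 * j + 4) - 1 = 4 * j + 7)%N by lia.
have -> : (2 * (2 * j + 4) - 2 = 4 * j + 6)%N by lia.
have -> : (2 * (2 * j + 4) - 3 = 4 * j + 5)%N by lia.
have -> : (2 * j + 4 - 1 = 2 * j + 3)%N by lia.
have -> : (2 * j + 4 - 2 = 2 * j + 2)%N by lia.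
have -> : (2 * j + 4 + 2 = 2 * j + 6)%N by lia.
rewrite !expE !big_cons big_nil /=.
have -> : y ^+ 2 * P ^+ 3 * (P - 1) = D by rewrite /D /q; ring.
have -> : y ^+ 1 * P ^+ 1 * (y ^+ 1 * P ^+ 3 - y ^+ 1 * P ^+ 2 - P + 1) =
  D - y * P * (P - 1) by rewrite /D /q; ring.
have -> : y ^+ 1 * P ^+ 2 * (y ^+ 1 * P ^+ 2 - y ^+ 1 * P ^+ 1 - P + 1) =
  D - y * P ^+ 2 * (P - 1) by rewrite /D /q; ring.
have -> : y ^+ 1 * P ^+ 1 * (y ^+ 1 * P ^+ 3 - y ^+ 1 * P ^+ 2 + P - 1) =
  D + y * P * (P - 1) by rewrite /D /q; ring.
have -> : y ^+ 1 * P ^+ 2 * (y ^+ 1 * P ^+ 2 - y ^+ 1 * P ^+ 1 + P - 1) =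
  D + y * P ^+ 2 * (P - 1) by rewrite /D /q; ring.
have -> : y ^+ 1 * P ^+ 1 * (y ^+ 1 * P ^+ 3 - y ^+ 1 * P ^+ 2 + 1) = D + y * P.
  by rewrite /D /q; ring.
have -> : y ^+ 1 * P ^+ 2 * (y ^+ 1 * P ^+ 2 - y ^+ 1 * P ^+ 1 + 1) = D + y * P ^+ 2.
  by rewrite /D /q; ring.
have -> : y ^+ 1 * P ^+ 1 * (y ^+ 1 * P ^+ 3 - y ^+ 1 * P ^+ 2 - 1) = D - y * P.
  by rewrite /D /q; ring.
have -> : y ^+ 1 * P ^+ 2 * (y ^+ 1 * P ^+ 2 - y ^+ 1 * P ^+ 1 - 1) = D - y * P ^+ 2.
  by rewrite /D /q; ring.
rewrite -/q; move: (I 0) (I D) (I q) (I (D - y * P)) (I (D + y * P)).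
move: (I (D - y * P * (P - 1))) (I (D + y * P * (P - 1))).
move: (I (D - y * P ^+ 2 * (P - 1))) (I (D + y * P ^+ 2 * (P - 1))).
move: (I (D - y * P ^+ 2)) (I (D + y * P ^+ 2)) => i1 i2 i3 i4 i5 i6 i7 i8 i9 i10 i11.
rewrite /q {D q}; move: y => Y; field.
by rewrite P_neq0 P1_neq0 P21_neq0.
Qed.

End Tables.

(** * The trace pairing and the fixed field of x -> x^(p^l) *)

Section Family.

Import GRing.Theory Num.Theory Order.TTheory.
Local Open Scope ring_scope.

Variables (p m' l : nat) (p_pr : prime p) (p_odd : odd p).
Hypothesis (l_gt0 : (0 < l)%N) (coprime_ml : gcdn m'.+1 l = 1%N).
Variables (F : finFieldType) (charFp : p \in [pchar F]).
Hypothesis cardF : #|F| = (p ^ m'.+1)%N.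

Notation L := (pPrimeCharType charFp).
Notation Tr := (FpTrace charFp).
Notation q := (p ^ m'.+1)%N.

Lemma tr0 : Tr 0 = 0.
Proof. by apply: (addrI (Tr 0)); rewrite -FpTraceD !addr0. Qed.

Lemma trN x : Tr (- x) = - Tr x.
Proof. by apply: (addrI (Tr x)); rewrite -FpTraceD !subrr tr0. Qed.

Lemma frob_iter_card (x : F) k : x ^+ (p ^ (m'.+1 * k)) = x.
Proof.
elim: k => [|k IHk]; first by rewrite muln0 expr1.
by rewrite mulnS expnD exprM -cardF expf_card.
Qed.

Lemma trXp (x : F) : Tr (x ^+ p) = Tr x.
Proof.
apply: (@Fp_alg_inj _ _ charFp); rewrite !(FpTrace_Frobenius _ _ cardF).
rewrite big_ord_recr [RHS]big_ord_recl /= expr1 addrC; congr (_ + _).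
  by rewrite -exprM -expnS -[m'.+1]muln1 frob_iter_card.
by apply: eq_bigr => i _; rewrite -exprM -expnS.
Qed.

Lemma trXpn (x : F) k : Tr (x ^+ (p ^ k)) = Tr x.
Proof.
elim: k => [|k IHk]; first by rewrite expr1.
by rewrite expnS mulnC exprM trXp.
Qed.

(** The trace is given by the sum of X^(p^i) for i < m. This polynomial is nonzero, with coefficient
    1 at X, and its degree is at most p^(m-1), too small to vanish on all of [F]. *)
Lemma tr_nontrivial : exists x : F, Tr x != 0.
Proof.
apply/existsP; apply: contraT; rewrite negb_exists => /forallP tr_0.
pose P : {poly F} := \sum_(i < m'.+1) 'X^(p ^ i).
have p_gt1 := prime_gt1 p_pr.
have nz_P : P != 0.
  apply/eqP=> /(congr1 (fun P : {poly F} => P`_1)); rewrite coef_sum coef0.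
  rewrite big_ord_recl /= coefXn eqxx big1 ?addr0 => [/eqP|i _].
    by rewrite oner_eq0.
  by rewrite coefXn ltn_eqF //= -{1}(expn0 p) ltn_exp2l.
have szP : (size P <= (p ^ m').+1)%N.
  apply: leq_trans (size_sum _ _ _) _; apply/bigmax_leqP => i _.
  by rewrite size_polyXn ltnS leq_exp2l // -ltnS.
have := max_poly_roots nz_P (rs := enum F) _ (enum_uniq _).
rewrite -cardE cardF => /(_ _)/leq_trans-/(_ _ _ szP).
rewrite ltnS leq_exp2l // ltnn; apply; apply/allP => x _; apply/eqP.
have := FpTrace_Frobenius charFp x cardF; have := tr_0 x; rewrite negbK => /eqP ->.
rewrite scale0r horner_sum => E; rewrite [RHS]E; apply: eq_bigr => i _.
by rewrite hornerXn.
Qed.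

Lemma tr_nondegenerate (x : F) : (forall y, Tr (x * y) = 0) -> x = 0.
Proof.
move=> x0; apply/eqP; apply: contraT => nz_x; have [y] := tr_nontrivial.
by rewrite -[y](mulVKf nz_x) x0 eqxx.
Qed.

Notation emb := (in_alg L).

Lemma trZ (t : 'F_p) (x : F) : Tr ((emb t : F) * x) = t * Tr x.
Proof. by rewrite -FpTraceZ; congr (Tr _); exact: (@mulr_algl _ L t x). Qed.

Lemma emb_exp_p (t : 'F_p) : (emb t : F) ^+ p = emb t.
Proof.
have tp : t ^+ p = t by have := expf_card t; rewrite card_Fp.
by have := rmorphXn emb p t; rewrite tp => E; exact: esym E.
Qed.

(** X^p - X has at most p roots, and the p elements of the prime field already are roots. *)
Lemma fixed_exp_p (x : F) : x ^+ p = x -> exists t : 'F_p, x = emb t.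
Proof.
move=> xp; case: (pickP (fun t : 'F_p => x == (emb t : F))) => [t /eqP|no_t].
  by exists t.
pose P : {poly F} := 'X^p - 'X; have p_gt1 := prime_gt1 p_pr.
have szP : size P = p.+1.
  by rewrite size_polyDl ?size_polyXn // size_polyN size_polyX ltnS.
have nz_P : P != 0 by rewrite -size_poly_eq0 szP.
have := @max_poly_roots _ P (x :: codom (fun t : 'F_p => emb t : F)) nz_P.
rewrite szP /= size_codom card_Fp // ltnn => H; exfalso; suff: false by [].
apply: H.
  rewrite /root !hornerE xp subrr eqxx /=; apply/allP => y /codomP[t ->].
  by rewrite /root !hornerE emb_exp_p subrr.
apply/andP; split.
  by apply/negP => /codomP[t /eqP]; rewrite no_t.
by apply/injectiveP; apply: (fmorph_inj emb).
Qed.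

(** As l is invertible modulo m, some iterate of the p^l-power map is x -> x^p. *)
Lemma fixed_exp_pl (x : F) : x ^+ (p ^ l) = x -> exists t : 'F_p, x = emb t.
Proof.
move=> xpl; apply: fixed_exp_p.
have iter_l k : x ^+ (p ^ (l * k)) = x.
  elim: k => [|k IHk]; first by rewrite muln0 expr1.
  by rewrite mulnS expnD exprM xpl.
have [u v E _] := egcdnP m'.+1 l_gt0.
have := iter_l u; rewrite mulnC E gcdnC coprime_ml addn1 expnSr exprM mulnC.
by rewrite frob_iter_card.
Qed.

Lemma frobD (x y : F) k : (x + y) ^+ (p ^ k) = x ^+ (p ^ k) + y ^+ (p ^ k).
Proof.
by apply: exprDn_pchar; rewrite pnatX (eq_pnat _ (pcharf_eq charFp)) pnat_id.
Qed.

Lemma frobN (x : F) k : (- x) ^+ (p ^ k) = - x ^+ (p ^ k).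
Proof. by rewrite exprNn -signr_odd oddX p_odd orbT mulN1r. Qed.

Lemma frobB (x y : F) k : (x - y) ^+ (p ^ k) = x ^+ (p ^ k) - y ^+ (p ^ k).
Proof. by rewrite frobD frobN. Qed.

(** * The quadratic forms of the family and their radicals *)

Definition trform (v : F * F) (x : F) : 'F_p :=
  Tr (v.1 * x ^+ (p ^ l).+1 + v.2 * x ^+ 2).

Notation "x ^phi" := (x ^+ (p ^ l)) (at level 3, format "x ^phi").

Lemma polar_trform v x y :
  polar (trform v) x y =
  Tr (v.1 * (x^phi * y + x * y^phi) + v.2 * x * y *+ 2).
Proof.
rewrite /polar /trform -!trN -!FpTraceD; congr (Tr _).
by rewrite !exprS frobD; ring.
Qed.

Lemma polar_trformDr v x y z :
  polar (trform v) x (y + z) = polar (trform v) x y + polar (trform v) x z.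
Proof.
by rewrite !polar_trform -FpTraceD frobD; congr (Tr _); ring.
Qed.

Lemma trformN v x : trform v (- x) = trform v x.
Proof. by rewrite /trform !exprS frobN; congr (Tr _); ring. Qed.

Lemma mulrn_p (x : F) : x *+ p = 0.
Proof. by rewrite -mulr_natr (pcharf0 charFp) mulr0. Qed.

Let cardF' : #|F| = (p * p ^ m')%N.
Proof. by rewrite cardF expnS. Qed.

Lemma two_neq0 : 2%:R != 0 :> F.
Proof.
rewrite -(dvdn_pcharf charFp) dvdn_prime2 //.
by apply: contraL p_odd => /eqP ->.
Qed.

(** Evaluate the polar form at (u, y') with y'^phi = y and apply phi inside the trace to the terms
    containing y'. It becomes Tr(M y) with M the left-hand side, and nondegeneracy gives M = 0. *)
Lemma radical_trform v u : u \in radical (trform v) ->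
  (v.1)^phi * (u^phi)^phi + (v.2)^phi * u^phi *+ 2 + v.1 * u = 0.
Proof.
move/radicalP => Ru; apply: tr_nondegenerate => y.
(* This exponent inverts phi, since m' l + l = m l and the p^m-power map is the identity. *)
pose y' := y ^+ (p ^ (m' * l)).
have y'E : y'^phi = y.
  by rewrite /y' -exprM -expnD addnC -mulSn -{2}[y](frob_iter_card y l).
have := Ru y'; rewrite polar_trform !mulrDr.
have -> : v.1 * (u^phi * y') + v.1 * (u * y'^phi) + v.2 * u * y' *+ 2 =
   (v.1 * u^phi * y' + v.2 * u * y' *+ 2) + v.1 * u * y by rewrite y'E; ring.
rewrite FpTraceD -(trXpn _ l) -FpTraceD => E; rewrite -[RHS]E; congr (Tr _).
by rewrite mulr2n !frobD !exprMn y'E; ring.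
Qed.

Definition phifix := [set x : F | x^phi == x].

Lemma emb_phi (t : 'F_p) : (emb t : F)^phi = emb t.
Proof.
elim: l => [|k IHk]; first by rewrite expr1.
by rewrite expnSr exprM IHk emb_exp_p.
Qed.

Lemma card_phifix : #|phifix| = p.
Proof.
rewrite -[RHS](card_Fp p_pr) -[RHS]cardsT.
rewrite -(card_imset _ (fmorph_inj emb : injective (fun t : 'F_p => emb t : F))).
apply: eq_card => x; rewrite inE; apply/eqP/imsetP => [/fixed_exp_pl[t ->]|[t _ ->]].
  by exists t; rewrite ?inE.
exact: emb_phi.
Qed.

(* If [u0 != 0] is a root of a [phi]-polynomial of degree 2, then the
   substitution [u = u0 w], [z = w^phi - w] lowers the degree to 1. *)
Lemma leq_card_radical v : v != 0 -> (#|radical (trform v)| <= p ^ 2)%N.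
Proof.
have p_gt0 := prime_gt0 p_pr.
case: v => a b nz_ab; set R := radical _.
have [a0|nz_a] := eqVneq a 0.
  have nz_b : b != 0 by apply: contra nz_ab => /eqP ->; rewrite a0.
  have /subset_leq_card : R \subset [set 0].
    apply/subsetP=> u /radical_trform /=; rewrite a0 mul0r addr0 expr0n.
    rewrite expn_eq0 (gtn_eqF p_gt0) /= mul0r add0r -mulr_natr => /eqP.
    rewrite !mulf_eq0 (negPf two_neq0) orbF !expf_eq0 (negPf nz_b) andbF /=.
    by case/andP=> _; rewrite inE.
  by rewrite cards1 => le_R1; apply: leq_trans le_R1 _; rewrite expn_gt0 p_gt0.
have [/subset_leq_card|] := boolP (R \subset [set 0]).
  by rewrite cards1 => le_R1; apply: leq_trans le_R1 _; rewrite expn_gt0 p_gt0.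
case/subsetPn=> u0 R_u0; rewrite inE => nz_u0.
pose A := a^phi * (u0^phi)^phi; pose D := a * u0.
pose z u := (u / u0)^phi - u / u0.
have nz_phi (x : F) : x != 0 -> x^phi != 0 by move=> nz_x; rewrite expf_neq0.
have nz_A : A != 0 by rewrite mulf_neq0 ?nz_phi.
have nz_D : D != 0 by rewrite mulf_neq0.
have zE u : u \in R -> A * (z u)^phi = D * z u.
  move=> R_u; have E0 := radical_trform R_u0; have E := radical_trform R_u.
  have uE : u = u0 * (u / u0) by rewrite mulrC divfK.
  move: E; rewrite {1 2 3}uE /z /A /D; move: (u / u0) => w.
  rewrite !exprMn frobB /= => E.
  rewrite /= in E0; apply/eqP; rewrite -subr_eq0; apply/eqP.
  (* The equation for u0 w minus w^phi times the equation for u0: the terms in b cancel. *)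
  transitivity ((a^phi * ((u0^phi)^phi * (w^phi)^phi) +
      b^phi * (u0^phi * w^phi) *+ 2 + a * (u0 * w)) - w^phi *
      (a^phi * (u0^phi)^phi + b^phi * u0^phi *+ 2 + a * u0)); first by ring.
  by rewrite E E0 mulr0 subr0.
(* Two elements with the same [z] differ by u0 times an element fixed by phi. *)
have fiberR u : u \in R -> (#|[set y in R | z y == z u]| <= p)%N.
  move=> R_u; rewrite -card_phifix.
  have inj : injective (fun y => (y - u) / u0).
    by move=> y y' /(divIf nz_u0)/addIr.
  rewrite -(card_imset _ inj); apply/subset_leq_card/subsetP=> w /imsetP[y].
  rewrite !inE => /andP[_ /eqP zy] ->.
  rewrite mulrBl frobB -subr_eq0; apply/eqP.
  by transitivity (z y - z u); [rewrite /z; ring|rewrite zy subrr].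
apply: leq_trans (leq_card_fibers fiberR) _; rewrite -mulnn leq_mul2r.
apply/orP; right.
have [sZ|] := boolP (z @: R \subset [set 0]).
  by apply: leq_trans (subset_leq_card sZ) _; rewrite cards1.
case/subsetPn=> w0 /imsetP[u1 R_u1 ->]; rewrite inE; set z1 := z u1 => nz_z1.
(* By [zE], the values of [z] on [R] divided by z1 are fixed by phi, so there are at most p of
   them. *)
rewrite -(card_imset _ (divIf nz_z1)) -card_phifix.
apply/subset_leq_card/subsetP=> w /imsetP[z2 /imsetP[u R_u ->] ->].
rewrite inE exprMn exprVn eqr_div ?nz_phi //; apply/eqP.
apply: (mulfI (mulf_neq0 nz_A nz_D)).
transitivity (A * (z u)^phi * (D * z1)); first by ring.
by rewrite zE // -[D * z1]zE //; ring.
Qed.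

Lemma card_radical_trform v : v != 0 ->
  exists k : 'I_3, #|radical (trform v)| = (p ^ k)%N.
Proof.
move=> nz_v; have := card_radical_dvd (polar_trformDr v).
rewrite cardF => /(dvdn_pfactor _ _ p_pr)[k _ E].
have := leq_card_radical nz_v; rewrite E leq_exp2l ?prime_gt1 // -ltnS => lt_k3.
by exists (Ordinal lt_k3).
Qed.

(** * Solution counts obtained by summing over all (a, b) *)

Lemma sum_tr_zker (c : F) t : c != 0 -> \sum_x zker (Tr (x * c) + t) = 0.
Proof.
move=> nz_c; have [y nz_y] := tr_nontrivial.
have := @translate_zker p p_pr F setT (fun x => Tr (x * c)) (y / c) (Tr y) _ _ nz_y (- t).
move=> H; rewrite -[RHS]H => [|x|x _]; rewrite ?inE //.
  by apply: eq_big => [x|x _]; rewrite ?inE ?opprK.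
by rewrite mulrDl FpTraceD divfK.
Qed.

(** For fixed i, the map (a, b) -> Tr(a X + b Y) is zero if X = Y = 0 and equidistributed otherwise,
    so a sum over the whole family becomes a count of common zeros. *)
Lemma sum_trform_zker (T : finType) (X Y : T -> F) :
  \sum_(v : F * F) \sum_i zker (Tr (v.1 * X i + v.2 * Y i)) =
  (p%:Z - 1) * q%:Z ^+ 2 * #|[set i | (X i == 0) && (Y i == 0)]|%:Z.
Proof.
rewrite exchange_big /= (bigID (fun i => (X i == 0) && (Y i == 0))) /=.
rewrite [X in _ + X]big1 ?addr0 => [|i].
  rewrite (eq_bigr (fun=> (p%:Z - 1) * q%:Z ^+ 2)) => [|i /andP[/eqP-> /eqP->]].
    rewrite sumr_const -[LHS]mulr_natr natz; congr (_ * Posz _).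
    by apply: eq_card => i; rewrite inE.
  under eq_bigr do rewrite !mulr0 addr0 tr0 zker0.
  by rewrite sumr_const card_prod cardF -mulr_natr natrM natz; ring.
rewrite -(pair_bigA _ (fun a b => zker (Tr (a * X i + b * Y i)))) /=.
rewrite negb_and => /orP[nz_X|nz_Y]; last first.
  rewrite big1 // => a _; rewrite -[RHS](sum_tr_zker (Tr (a * X i)) nz_Y).
  by apply: eq_bigr => b _; rewrite addrC FpTraceD.
rewrite exchange_big big1 //= => b _; rewrite -[RHS](sum_tr_zker (Tr (b * Y i)) nz_X).
by apply: eq_bigr => a _; rewrite FpTraceD.
Qed.

Notation phi1 x := (x ^+ (p ^ l).+1).

Lemma card_zeros1 : #|[set x : F | (phi1 x == 0) && (x ^+ 2 == 0)]| = 1%N.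
Proof.
rewrite -[RHS](cards1 (0 : F)); apply: eq_card => x; rewrite !inE !expf_eq0 /=.
by rewrite andbb.
Qed.

(** From x^2 = y^2 follows x = y or x = - y, and both satisfy the other equation since p^l + 1 is
    even; the two lines share only the origin. *)
Lemma card_zeros2 :
  #|[set i : F * F | (phi1 i.1 - phi1 i.2 == 0) && (i.1 ^+ 2 - i.2 ^+ 2 == 0)]|
  = (2 * q - 1)%N.
Proof.
pose D := [set (y, y) | y : F]; pose D' := [set (- y, y) | y : F].
have oppE (y : F) : (- y == y) = (y == 0).
  rewrite -subr_eq0 -opprD oppr_eq0 -mulr2n -mulr_natr mulf_eq0.
  by rewrite (negPf two_neq0) orbF.
have cD : #|D| = q by rewrite card_imset ?cardF // => x y [].
have cD' : #|D'| = q by rewrite card_imset ?cardF // => x y [].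
have cI : #|D :&: D'| = 1%N.
  rewrite -[RHS](cards1 (0 : F * F)%type); apply: eq_card => -[x y]; rewrite !inE.
  apply/andP/eqP => [[/imsetP[z _ [-> ->]] /imsetP[w _ [zw zw']]]|[-> ->]].
    have /eqP : - z = z by rewrite {1}zw' -zw.
    by rewrite oppE => /eqP ->.
  by split; apply/imsetP; exists 0; rewrite ?oppr0.
have := cardsU D D'; rewrite cD cD' cI addnn -mul2n => <-.
apply: eq_card => -[x y]; rewrite !inE /= [X in _ && X]subr_eq0 eqf_sqr.
apply/idP/idP => [/andP[_ /orP[] /eqP ->]|].
- by apply/orP; left; apply/imsetP; exists y.
- by apply/orP; right; apply/imsetP; exists y.
case/orP=> /imsetP[z _ [-> ->]]; first by rewrite subrr !eqxx.
by rewrite !exprS frobN mulrNN subrr !eqxx orbT.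
Qed.

(** For a nonzero solution, dividing the equations shows that x / y is fixed by phi, hence lies in
    the prime field, where its square would be [s]. *)
Lemma card_zeros_nonsquare (s : 'F_p) : (forall x : 'F_p, x ^+ 2 != s) ->
  #|[set i : F * F | (phi1 i.1 - (emb s : F) * phi1 i.2 == 0) &&
                     (i.1 ^+ 2 - (emb s : F) * i.2 ^+ 2 == 0)]| = 1%N.
Proof.
move=> s_nsq; rewrite -[RHS](cards1 (0 : F * F)%type); apply: eq_card => -[x y].
rewrite !inE /=; apply/andP/eqP => [[]|[-> ->]]; last first.
  by rewrite !expr0n /= mulr0 subrr.
rewrite !subr_eq0 exprS => /eqP X2 /eqP Y2.
have [y0|nz_y] := eqVneq y 0.
  move: Y2; rewrite y0 expr0n mulr0 => /eqP; rewrite expf_eq0 => /andP[_ /eqP ->].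
  by [].
have nz_yphi : y^phi != 0 by rewrite expf_neq0.
have nz_s : (emb s : F) != 0.
  rewrite (fmorph_eq0 emb); have := s_nsq 0; by rewrite expr0n eq_sym.
have nz_x : x != 0.
  apply: contraTneq nz_y => x0; move: Y2; rewrite x0 expr0n => /eqP.
  by rewrite eq_sym mulf_eq0 (negPf nz_s) expf_eq0 /= => /eqP ->; rewrite eqxx.
have [t tE] : exists t : 'F_p, x / y = emb t.
  apply: fixed_exp_pl; rewrite exprMn exprVn; apply/eqP.
  rewrite eqr_div //; apply/eqP; apply: (mulfI nz_x).
  rewrite mulrA X2 mulrA -expr2 Y2 exprS; ring.
have sE : (emb s : F) = (x / y) ^+ 2.
  by apply: (mulIf (expf_neq0 2 nz_y)); rewrite -exprMn divfK.
case/eqP: (s_nsq t); apply: (fmorph_inj emb); rewrite rmorphXn.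
by rewrite tE in sE; apply: esym sE.
Qed.

(** The solutions with x = y have z = 0 and form [D]. Otherwise t = z / (x - y) lies in the prime
    field, and the solution is the Pythagorean triple (t^2 + 1, t^2 - 1, 2 t) scaled by w = (x - y)
    / 2; these form [E]. *)
Lemma card_zeros3 :
  #|[set i : F * (F * F) |
      (phi1 i.1 - (phi1 i.2.1 + phi1 i.2.2) == 0) &&
      (i.1 ^+ 2 - (i.2.1 ^+ 2 + i.2.2 ^+ 2) == 0)]| = (q + (q - 1) * p)%N.
Proof.
have two_phi : (2%:R : F)^phi = 2%:R by rewrite mulr2n frobD expr1n.
pose D := [set (x, (x, 0 : F)) | x : F].
pose g (i : F * 'F_p) : F * (F * F) :=
  (((emb i.2 : F) ^+ 2 + 1) * i.1,
   (((emb i.2 : F) ^+ 2 - 1) * i.1, 2%:R * (emb i.2 : F) * i.1)).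
pose E := g @: setX [set~ 0] setT.
have cD : #|D| = q by rewrite card_imset ?cardF // => x y [].
have cE : #|E| = ((q - 1) * p)%N.
  rewrite card_in_imset ?cardsX ?cardsC1 ?cardsT ?card_Fp ?cardF ?subn1 //.
  move=> [w d] [w' d']; rewrite !inE !andbT /= => nz_w nz_w' [E1 E2 E3].
  have ww' : w = w'.
    apply: (mulfI two_neq0).
    transitivity (((emb d : F) ^+ 2 + 1) * w - ((emb d : F) ^+ 2 - 1) * w).
      by ring.
    by rewrite E1 E2; ring.
  rewrite -{}ww' in E3 *; congr (_, _).
  by move: E3 => /(mulIf nz_w)/(mulfI two_neq0)/(fmorph_inj emb).
have DE0 : D :&: E = set0.
  apply/setP=> i; rewrite !inE; apply/negP => /andP[/imsetP[x _ ->]].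
  case/imsetP=> -[w d]; rewrite !inE andbT /= => nz_w [E1 E2 _].
  have : 2%:R * w = 0 by rewrite -(subrr x) {1}E1 E2; ring.
  by move/eqP; rewrite mulf_eq0 (negPf two_neq0) (negPf nz_w).
have := cardsUI D E; rewrite DE0 cards0 addn0 cD cE => <-.
apply: eq_card => -[x [y z]]; rewrite !inE /=; apply/andP/orP; last first.
  case=> /imsetP[]; first by move=> w _ [-> -> ->]; rewrite !expr0n !addr0 !subrr.
  move=> [w d] _; rewrite /g; change (w, d).1 with w; change (w, d).2 with d.
  move: (emb d : F) (emb_phi d) => t t_phi [-> -> ->].
  have t2_phi : (t ^+ 2)^phi = t ^+ 2 by rewrite exprAC t_phi.
  rewrite !(exprS _ (p ^ l)) !(exprMn (p ^ l)) frobB frobD two_phi t2_phi t_phi !expr1n.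
  by split; apply/eqP; ring.
rewrite !subr_eq0 !(exprS _ (p ^ l)) => -[/eqP X3 /eqP Y3].
have [xy|nz_v] := eqVneq (x - y) 0.
  left; apply/imsetP; exists x => //; move/eqP: xy; rewrite subr_eq0 => /eqP xy.
  move/eqP: Y3; rewrite -xy -{1}[x ^+ 2]addr0 (inj_eq (addrI _)) eq_sym.
  by rewrite expf_eq0 => /andP[_ /eqP ->].
right; set v := x - y in nz_v *; pose u := x + y.
have uv : u * v = z ^+ 2 by rewrite /u /v -[LHS]subr0 -(subrr (x ^+ 2)) {2}Y3; ring.
have uvphi : u^phi * v^phi = (z^phi) ^+ 2 by rewrite -exprMn uv exprAC.
have uvS : u^phi * v + u * v^phi = 2%:R * (z * z^phi).
  have -> : z * z^phi = x * x^phi - y * y^phi by rewrite X3; ring.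
  by rewrite /u /v frobB frobD; ring.
(* The square of the difference of the two sides is the square of their sum minus 4 u v (u v)^phi,
   which is 0. *)
have uvphi_eq : u^phi * v = u * v^phi.
  apply/eqP; rewrite -subr_eq0 -[_ == 0](expf_eq0 _ 2); apply/eqP.
  transitivity ((u^phi * v + u * v^phi) ^+ 2 - 2%:R ^+ 2 * (u * v) * (u^phi * v^phi)).
    by ring.
  by rewrite uvS uv uvphi; ring.
have zzphi : u * v^phi = z * z^phi.
  by apply: (mulfI two_neq0); rewrite -uvS uvphi_eq; ring.
have nz_vphi : v^phi != 0 by rewrite expf_neq0.
have [d dE] : exists d : 'F_p, z / v = emb d.
  apply: fixed_exp_pl; rewrite exprMn exprVn; apply/eqP; rewrite eqr_div //.
  have [z0|nz_z] := eqVneq z 0.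
    by rewrite z0 expr0n expn_eq0 (gtn_eqF (prime_gt0 p_pr)) /= !mul0r.
  apply/eqP; apply: (mulfI nz_z); rewrite mulrA -zzphi mulrA -expr2 -uv; ring.
apply/imsetP; exists (v / 2%:R, d).
  by rewrite !inE andbT mulf_neq0 ?invr_eq0 ?two_neq0.
rewrite /g; change (v / 2%:R, d).1 with (v / 2%:R); change (v / 2%:R, d).2 with d.
move: (emb d : F) dE => t <-; have nz2 := two_neq0.
have d2 : (z / v) ^+ 2 * v = u.
  by apply: (mulIf nz_v); rewrite -mulrA -expr2 -exprMn divfK // uv.
have E1 : (z / v) ^+ 2 * (v / 2%:R) = u / 2%:R by rewrite mulrA d2.
congr (_, (_, _)).
- by rewrite mulrDl E1 mul1r -mulrDl /u /v; apply: (mulIf nz2); rewrite divfK //; ring.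
- by rewrite mulrBl E1 mul1r -mulrBl /u /v; apply: (mulIf nz2); rewrite divfK //; ring.
- by rewrite mulrAC [2%:R * _]mulrC divfK // mulrC divfK.
Qed.

(** * Corank and moments of the family *)

Notation rho v := #|radical (trform v)|.
Notation f v := (excess (trform v) (p ^ m')).

Definition corank v := logn p (rho v).

Lemma card_radicalE v : rho v = (p ^ corank v)%N.
Proof.
have := card_radical_dvd (polar_trformDr v).
rewrite cardF => /(dvdn_pfactor _ _ p_pr)[k _ E].
by rewrite /corank E pfactorK.
Qed.

Lemma corank_lt3 v : v != 0 -> (corank v < 3)%N.
Proof.
by move=> /card_radical_trform[k E]; rewrite /corank E pfactorK.
Qed.

Lemma trform0 x : trform 0 x = 0.
Proof. by rewrite /trform !mul0r addr0 tr0. Qed.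

Lemma card_radical0 : rho 0 = q.
Proof.
rewrite -cardF -[RHS]cardsT; apply: eq_card => x; rewrite inE [RHS]inE.
by apply/forallP => y; rewrite /polar !trform0 !subr0.
Qed.

Lemma corank0 : corank 0 = m'.+1.
Proof. by rewrite /corank card_radical0 pfactorK. Qed.

Lemma excess00 : p%:Z * f 0 0 = (p%:Z - 1) * q%:Z.
Proof.
rewrite /excess (eq_card (B := setT)) => [|x]; last by rewrite !inE trform0 eqxx.
by rewrite cardsT cardF expnS PoszM; ring.
Qed.

Let Crho v : (p ^ m' * rho v)%N = (p ^ (m' + corank v))%N.
Proof. by rewrite card_radicalE expnD. Qed.

Lemma trform_parity v :
  if odd (m' + corank v)
  then exists2 b : int, b ^+ 2 = (p ^ (m' + corank v).-1)%N%:Z &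
                        forall t, f v t = - b * zker t
  else [/\ f v 0 = 0, forall t, t != 0 -> f v t ^+ 2 = (p ^ (m' + corank v))%N%:Z &
      forall s t, (forall x : 'F_p, x ^+ 2 != s) -> f v (s * t) = - f v t].
Proof.
exact: (excess_parity p_pr p_odd mulrn_p (polar_trformDr v) (trformN v) cardF' (Crho v)).
Qed.

Lemma moment1 : \sum_(v : F * F) p%:Z * f v 0 = (p%:Z - 1) * q%:Z ^+ 2.
Proof.
transitivity (\sum_(v : F * F) \sum_x zker (Tr (v.1 * phi1 x + v.2 * x ^+ 2))).
  apply: eq_bigr => v _; rewrite -(sum_quad_zker _ cardF').
  by apply: eq_bigr => x _; rewrite subr0.
by rewrite sum_trform_zker card_zeros1 mulr1.
Qed.

Lemma moment2 : \sum_(v : F * F) (p%:Z - 1) * q%:Z * (rho v)%:Z =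
  (p%:Z - 1) * q%:Z ^+ 2 * (2 * q%:Z - 1).
Proof.
transitivity (\sum_(v : F * F) \sum_(i : F * F)
    zker (Tr (v.1 * (phi1 i.1 - phi1 i.2) + v.2 * (i.1 ^+ 2 - i.2 ^+ 2)))).
  apply: eq_bigr => v _; rewrite expnS.
  rewrite -(sum_quadB_zker p_pr p_odd (polar_trformDr v) (trformN v) cardF').
  rewrite pair_bigA; apply: eq_bigr => i _; rewrite /trform -trN -FpTraceD.
  by congr (zker (Tr _)); ring.
rewrite sum_trform_zker card_zeros2; congr (_ * _).
have : (0 < q)%N by rewrite expn_gt0 prime_gt0.
by lia.
Qed.

(** The sign records the parity of the rank, so comparison with [moment2] separates corank 1 from
    coranks 0 and 2. *)
Lemma moment2_nonsquare :
  \sum_(v : F * F) (-1) ^+ (~~ odd (m' + corank v)) *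
     ((p%:Z - 1) * q%:Z * (rho v)%:Z) = (p%:Z - 1) * q%:Z ^+ 2.
Proof.
have [s s_nsq] := ex_nonsquare p_pr p_odd.
transitivity (\sum_(v : F * F) \sum_(i : F * F)
    zker (Tr (v.1 * (phi1 i.1 - (emb s : F) * phi1 i.2) +
              v.2 * (i.1 ^+ 2 - (emb s : F) * i.2 ^+ 2)))).
  apply: eq_bigr => v _; rewrite expnS.
  rewrite -(sum_quad_nonsquare_zker p_pr p_odd mulrn_p (polar_trformDr v) (trformN v)
             cardF' (Crho v) s_nsq).
  rewrite pair_bigA; apply: eq_bigr => i _; rewrite /trform -trZ -trN -FpTraceD.
  by congr (zker (Tr _)); move: (emb s : F) => t; ring.
by rewrite sum_trform_zker card_zeros_nonsquare // mulr1.
Qed.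

(** For even m, weighting by the order of the radical separates the signs in corank 0 from those in
    corank 2. *)
Lemma moment3 :
  \sum_(v : F * F) p%:Z * f v 0 * (q%:Z * (rho v)%:Z) =
  (p%:Z - 1) * q%:Z ^+ 2 * (q%:Z + (q%:Z - 1) * p%:Z).
Proof.
transitivity (\sum_(v : F * F) \sum_(i : F * (F * F))
    zker (Tr (v.1 * (phi1 i.1 - (phi1 i.2.1 + phi1 i.2.2)) +
              v.2 * (i.1 ^+ 2 - (i.2.1 ^+ 2 + i.2.2 ^+ 2))))).
  apply: eq_bigr => v _; rewrite [in (q%:Z)]expnS.
  rewrite -(sum_quad3_zker p_pr p_odd mulrn_p (polar_trformDr v) (trformN v)
             cardF' (Crho v)).
  under eq_bigr do rewrite pair_bigA; rewrite pair_bigA.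
  apply: eq_bigr => i _; rewrite /trform -FpTraceD -trN -FpTraceD.
  by congr (zker (Tr _)) => /=; ring.
rewrite sum_trform_zker card_zeros3; congr (_ * _).
have : (0 < q)%N by rewrite expn_gt0 prime_gt0.
by move=> q_gt0; rewrite PoszD PoszM -subzn.
Qed.

(** * The effect of the linear term Tr(c x) *)

Definition zcount (v : F * F) (c : F) (h : 'F_p) :=
  #|[set x | trform v x + Tr (c * x) + h == 0]|.

(* [_ ^+ (p ^ (m' * l))] is the inverse of [_^phi]. *)
Definition theta (v : F * F) (x : F) : F :=
  v.1 * x^phi + (v.1 * x) ^+ (p ^ (m' * l)) + v.2 * x *+ 2.

(** The inverse of phi preserves the trace and turns the term in y^phi of the polar form into one in
    y. *)
Lemma tr_theta v x y : Tr (theta v x * y) = polar (trform v) x y.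
Proof.
rewrite polar_trform /theta !mulrDl !mulrDr.
rewrite addrAC [in RHS]addrAC [LHS]FpTraceD [RHS]FpTraceD.
congr (_ + _); first by congr (Tr _); ring.
rewrite -[LHS](trXpn _ l) exprMn -exprM -expnD addnC -mulSn frob_iter_card.
by rewrite mulrA.
Qed.

Lemma theta_eq v x y : (theta v x == theta v y) = (x - y \in radical (trform v)).
Proof.
have polarBl z : polar (trform v) (x - y) z =
    polar (trform v) x z - polar (trform v) y z.
  rewrite ![polar _ _ z]polarC (polar_trformDr v).
  by rewrite (polarNr (polar_trformDr v)).
apply/eqP/radicalP => [xy z|Rxy]; first by rewrite polarBl -!tr_theta xy subrr.
apply/eqP; rewrite -subr_eq0; apply/eqP/tr_nondegenerate => z.
by rewrite mulrBl FpTraceD trN !tr_theta -polarBl Rxy.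
Qed.

Lemma sum_theta v (g : F -> rat) :
  \sum_x g (theta v x) = (rho v)%:R * \sum_(c in theta v @: setT) g c.
Proof.
rewrite (partition_big (theta v) (mem (theta v @: setT))) /=; last first.
  by move=> x _; apply: imset_f.
rewrite mulr_sumr; apply: eq_bigr => _ /imsetP[x0 _ ->].
rewrite (eq_bigr (fun=> g (theta v x0))) => [|x /eqP -> //].
rewrite sumr_const -[LHS]mulr_natl; congr (_%:R * _).
rewrite -[RHS](card_imset _ (addrI x0)); apply: eq_card => x.
transitivity (theta v x == theta v x0); first by [].
rewrite theta_eq; apply/idP/imsetP => [Rx|[u Ru ->]].
  by exists (x - x0); rewrite // addrC subrK.
by rewrite addrC addKr.
Qed.

Lemma card_theta_image v : ((rho v) * #|theta v @: setT|)%N = q.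
Proof.
have := sum_theta v (fun=> 1); rewrite !sumr_const cardF -natrM => /eqP.
by rewrite eqr_nat => /eqP ->.
Qed.

(** The image of [theta v] lies in the annihilator of the radical for the trace pairing. Both have q
    / rho elements, so they coincide. *)
Lemma theta_image v c :
  c \notin theta v @: setT -> exists2 u, u \in radical (trform v) & Tr (c * u) != 0.
Proof.
pose ann := [set c | [forall u in radical (trform v), Tr (c * u) == 0]].
have sub_ann : theta v @: setT \subset ann.
  apply/subsetP=> _ /imsetP[x _ ->]; rewrite inE; apply/forall_inP => u /radicalP Ru.
  by rewrite tr_theta polarC Ru.
have p1_neq0 : p%:Z - 1 != 0 by have := prime_gt1 p_pr; lia.
have nonann d : d \notin ann -> exists2 u, u \in radical (trform v) & Tr (d * u) != 0.
  by rewrite inE negb_forall_in => /exists_inP.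
have card_ann : (rho v * #|ann|)%N = q.
  apply/eqP; rewrite -(eqr_nat int); apply/eqP; apply: (mulfI p1_neq0).
  (* Summed over u first, only the d in [ann] contribute; summed over d first, only u = 0 does. *)
  transitivity (\sum_(u in radical (trform v)) \sum_d zker (Tr (d * u))).
    rewrite exchange_big (bigID (mem ann)) /= [X in _ = _ + X]big1 ?addr0.
      rewrite (eq_bigr (fun=> (p%:Z - 1) * (rho v)%:R)) => [|d].
        by rewrite sumr_const -[RHS]mulr_natr natrM mulrA.
      rewrite inE => /forall_inP Ad; rewrite (eq_bigr (fun=> p%:Z - 1)) => [|u Ru].
        by rewrite sumr_const mulr_natr.
      by rewrite (eqP (Ad u Ru)) zker0.
    move=> d /nonann[u Ru nz_u].
    have := @translate_zker p p_pr F (radical (trform v)) (fun x => Tr (d * x))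
      u _ _ _ nz_u 0.
    move=> H; rewrite -[RHS]H => [|x Rx|x _].
    - by apply: eq_bigr => x _; rewrite subr0.
    - apply/radicalP => z; rewrite polarC (polar_trformDr v).
      by rewrite ![polar _ z _]polarC (radicalP _ _ Rx) (radicalP _ _ Ru) addr0.
    by rewrite mulrDr FpTraceD.
  rewrite (bigD1 0) /=; last first.
    by apply/radicalP => x; rewrite polarC (polar0r (polar_trformDr v)).
  rewrite [X in _ + X]big1 ?addr0 => [|u /andP[_ nz_u]]; last first.
    by rewrite -[RHS](sum_tr_zker 0 nz_u); apply: eq_bigr => d _; rewrite addr0.
  under eq_bigr do rewrite mulr0 tr0 zker0.
  by rewrite sumr_const cardF mulr_natr.
have -> : theta v @: setT = ann.
  apply/eqP; rewrite eqEcard sub_ann /=.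
  have := card_theta_image v; rewrite -{1}card_ann => /eqP.
  rewrite eqn_pmul2l; first by move/eqP->.
  by rewrite card_radicalE expn_gt0 prime_gt0.
exact: nonann.
Qed.

(** The first term collects the c outside the image of [theta v], where every h gives p^m' zeros.
    For each of the q / rho elements c of the image, every fiber of the form occurs once as h
    varies. *)
Lemma sum_zcount v (psi : nat -> rat) :
  \sum_c \sum_h psi (zcount v c h) =
  (q%:R - q%:R / (rho v)%:R) * p%:R * psi (p ^ m')%N +
  q%:R / (rho v)%:R * \sum_t psi #|[set x | trform v x == t]|.
Proof.
have nz_rho : (rho v)%:R != 0 :> rat.
  by rewrite pnatr_eq0 card_radicalE expn_eq0 (gtn_eqF (prime_gt0 p_pr)).
have card_im : #|theta v @: setT|%:R = q%:R / (rho v)%:R :> rat.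
  by rewrite -(card_theta_image v) natrM mulrC mulKf.
rewrite (bigID (mem (theta v @: setT))) /= addrC; congr (_ + _).
  rewrite (eq_bigr (fun=> p%:R * psi (p ^ m')%N)) => [|c /theta_image[u Ru nz_u]].
    rewrite sumr_const -mulrA -[LHS]mulr_natl; congr (_ * _).
    rewrite -card_im -cardF -natrB; last exact: max_card.
    congr (_%:R); apply/eqP; rewrite -(eqn_add2l #|theta v @: setT|) subnKC ?max_card //.
    by rewrite -(cardC (mem (theta v @: setT))).
  rewrite (eq_bigr (fun=> psi (p ^ m')%N)) => [|h _].
    by rewrite sumr_const card_Fp // -[LHS]mulr_natl.
  congr psi; apply: (card_zeros_affine_balanced p_pr p_odd (polar_trformDr v)
    (trformN v) cardF' _ _ Ru nz_u).
  by move=> x y; rewrite mulrDr FpTraceD.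
rewrite (eq_bigr (fun=> \sum_t psi #|[set x | trform v x == t]|)); last first.
  move=> _ /imsetP[x0 _ ->].
  rewrite [RHS](reindex_inj (inv_inj (subKr (trform v x0)))) /=.
  apply: eq_bigr => h _; congr psi; rewrite -card_zeros_affine_polar.
  by apply: eq_card => x; rewrite !inE tr_theta.
by rewrite sumr_const -[LHS]mulr_natl card_im.
Qed.

(** A form that agrees with an additive map has zero polar form, so its radical is all of [F], of
    order p^m > p^2, which [leq_card_radical] allows only for v = 0. *)
Lemma trform_full_kernel v c h : (2 <= m')%N ->
  (forall x, trform v x + Tr (c * x) + h = 0) -> [/\ v = 0, c = 0 & h = 0].
Proof.
move=> m_ge2 vch0.
have h0 : h = 0.
  by have := vch0 0; rewrite (quad0 (polar_trformDr v)) mulr0 tr0 !add0r.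
have QE x : trform v x = - Tr (c * x).
  by apply/eqP; rewrite -addr_eq0; have := vch0 x; rewrite h0 addr0 => ->.
have v0 : v = 0.
  apply/eqP; apply: contraT => /leq_card_radical.
  suff -> : rho v = q by rewrite leq_exp2l ?prime_gt1 // leqNgt ltnS m_ge2.
  rewrite -cardF -[RHS]cardsT; apply: eq_card => x; rewrite [RHS]inE.
  by apply/radicalP => y; rewrite /polar !QE mulrDr FpTraceD; ring.
split=> //; apply: tr_nondegenerate => x.
by have := QE x; rewrite v0 trform0 => /esym/eqP; rewrite oppr_eq0 => /eqP.
Qed.

Lemma trformB v v' x : trform (v - v') x = trform v x - trform v' x.
Proof. by rewrite /trform -trN -FpTraceD /=; congr (Tr _); ring. Qed.

(** * The code: injective encoding, dimension and weights *)

Section Code.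

Variable e : 'I_q -> F.
Hypothesis e_bij : bijective e.

Definition encode (i : (F * F) * (F * 'F_p)) : 'rV['F_p]_q :=
  codeword l charFp e i.1.1 i.1.2 i.2.1 i.2.2.

Lemma encodeE i j : encode i 0 j = trform i.1 (e j) + Tr (i.2.1 * e j) + i.2.2.
Proof. by rewrite /encode /codeword mxE FpTraceD. Qed.

Lemma encode_inj : (2 <= m')%N -> injective encode.
Proof.
have [e' e'K eK] := e_bij.
move=> m_ge2 [v [c h]] [v' [c' h']] E.
have [] := @trform_full_kernel (v - v') (c - c') (h - h') m_ge2.
  move=> x; have /rowP/(_ (e' x)) := E; rewrite !encodeE /= !eK => Ex.
  rewrite trformB mulrBl FpTraceD trN.
  transitivity ((trform v x + Tr (c * x) + h) - (trform v' x + Tr (c' * x) + h')).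
    by ring.
  by rewrite Ex subrr.
by move=> /eqP + /eqP + /eqP; rewrite !subr_eq0 => /eqP -> /eqP -> /eqP ->.
Qed.

Lemma code_encode : code l charFp e = [set encode i | i in setT].
Proof.
apply/setP=> w; apply/codeP/imsetP => [[a [b [c [h ->]]]]|[[[a b] [c h]] _ ->]].
  by exists ((a, b), (c, h)).
by exists a, b, c, h.
Qed.

Lemma card_code : (2 <= m')%N -> #|code l charFp e| = (p ^ (3 * m'.+1 + 1))%N.
Proof.
move=> /encode_inj inj; rewrite code_encode card_imset // cardsT !card_prod cardF.
by rewrite card_Fp // -expnSr -!expnD; congr (_ ^ _)%N; lia.
Qed.

(** The code equals its span, so its order determines its dimension. *)
Lemma code_dimE : (2 <= m')%N -> code_dim (code l charFp e) = (3 * m'.+1 + 1)%N.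
Proof.
move=> /card_code cardC; apply/eqP; rewrite -(eqn_exp2l _ _ (prime_gt1 p_pr)).
by rewrite -cardC -(eq_card (code_span l charFp e)) card_vspace card_Fp.
Qed.

Lemma hweight_encode v c h : hweight (encode (v, (c, h))) = (q - zcount v c h)%N.
Proof.
rewrite /hweight /zcount.
have -> : #|[set x | trform v x + Tr (c * x) + h == 0]| =
          #|[set j | encode (v, (c, h)) 0 j == 0]|.
  rewrite -(card_imset _ (bij_inj e_bij)); apply: eq_card => x; rewrite inE.
  have [e' e'K eK] := e_bij.
  apply/idP/imsetP => [x0|[j]]; last by rewrite inE encodeE => j0 ->.
  by exists (e' x); rewrite ?inE ?encodeE eK.
set A := [set j | _ == 0]; have -> : [set i | encode (v, (c, h)) 0 i != 0] = ~: A.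
  by apply/setP=> j; rewrite !inE.
by have := cardsC A; rewrite card_ord; lia.
Qed.

Lemma card_hweight (w : nat) : (2 <= m')%N ->
  #|[set c in code l charFp e | hweight c == w]|%:R =
  \sum_(v : F * F) \sum_c \sum_h
     (q%:R - (zcount v c h)%:R == w%:R :> rat)%:R :> rat.
Proof.
move=> m_ge2; under [RHS]eq_bigr do rewrite pair_bigA; rewrite pair_bigA.
transitivity (\sum_(i in [set i | hweight (encode i) == w]) 1 : rat).
  rewrite sumr_const; congr (_%:R); rewrite -(card_imset _ (encode_inj m_ge2)).
  rewrite code_encode; apply: eq_card => c; rewrite inE.
  apply/andP/imsetP => [[/imsetP[i _ ->] wi]|[i]]; first by exists i; rewrite ?inE.
  by rewrite inE => wi ->; rewrite wi imset_f.
rewrite big_mkcond /=; apply: eq_bigr => -[v [c h]] _ /=; rewrite inE hweight_encode.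
rewrite -natrB ?eqr_nat; first by case: eqP.
by rewrite -cardF max_card.
Qed.

End Code.

(** * Classes of forms by corank and sign *)

(** For odd rank the excess at 0 is zero and [pos] is false. *)
Definition pos v := 0 < f v 0.

Definition class_card k s :=
  #|[set v : F * F | [&& v != 0, corank v == k & pos v == s]]|.

Lemma class_sum (G : nat -> bool -> rat) :
  \sum_(v : F * F | v != 0) G (corank v) (pos v) =
  \sum_(k < 3) ((class_card k true)%:R * G k true + (class_card k false)%:R * G k false).
Proof.
rewrite (partition_big (fun v => inord (corank v) : 'I_3) predT) //=.
apply: eq_bigr => k _; rewrite (bigID pos) /=.
have val_k v : v != 0 -> (inord (corank v) == k) = (corank v == k :> nat).
  by move=> nz_v; rewrite -val_eqE /= inordK ?corank_lt3.
congr (_ + _).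
  rewrite (eq_bigr (fun=> G k true)) => [|v /andP[/andP[nz_v]]]; last first.
    by rewrite val_k // => /eqP -> ->.
  rewrite sumr_const -[LHS]mulr_natl; congr (_%:R * _); apply: eq_card => v.
  rewrite [RHS]inE unfold_in; case: eqVneq => //= nz_v.
  by rewrite val_k //; case: (pos v).
rewrite (eq_bigr (fun=> G k false)) => [|v /andP[/andP[nz_v]]]; last first.
  by rewrite val_k // => /eqP -> /negPf ->.
rewrite sumr_const -[LHS]mulr_natl; congr (_%:R * _); apply: eq_card => v.
rewrite [RHS]inE unfold_in; case: eqVneq => //= nz_v.
by rewrite val_k //; case: (pos v).
Qed.

(** For even rank, the integer b such that f = - b [zker]; its sign is opposite to that of the
    excess at 0. As m' + k is then odd, the halving gives (m' + k - 1) / 2. *)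
Definition beta k (s : bool) : int := (-1) ^+ s * (p ^ (m' + k)./2)%N%:Z.

Lemma trform_even v : odd (m' + corank v) ->
  forall t, f v t = - beta (corank v) (pos v) * zker t.
Proof.
move=> e_odd; have := trform_parity v; rewrite e_odd => -[b b2 fE].
suff <- : b = beta (corank v) (pos v) by [].
have p_gt1 := prime_gt1 p_pr.
have P_gt0 : (0 < p ^ (m' + corank v)./2)%N by rewrite expn_gt0 ltnW.
have : b ^+ 2 = (p ^ (m' + corank v)./2)%N%:Z ^+ 2.
  rewrite b2 expr2 -PoszM mulnn -expnM; congr (Posz (p ^ _)).
  by rewrite muln2 -[in LHS](odd_double_half (m' + corank v)) e_odd.
rewrite /beta /pos fE zker0.
move: (p ^ _)%N P_gt0 => P P_gt0 /eqP; rewrite eqf_sqr => /orP[] /eqP ->.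
  have -> : 0 < - P%:Z * (p%:Z - 1) = false by nia.
  by rewrite mul1r.
have -> : 0 < - - P%:Z * (p%:Z - 1) by nia.
by rewrite mulN1r.
Qed.

Lemma trform_odd v : ~~ odd (m' + corank v) ->
  [/\ f v 0 = 0,
      forall t, t != 0 -> f v t ^+ 2 = (p ^ (m' + corank v)./2)%N%:Z ^+ 2 &
      forall s t, (forall x : 'F_p, x ^+ 2 != s) -> f v (s * t) = - f v t].
Proof.
move=> e_even; have := trform_parity v; rewrite (negPf e_even) => -[f0 f2 fs].
split=> // t /f2 ->; rewrite expr2 -PoszM mulnn -expnM; congr (Posz (p ^ _)).
by rewrite muln2 -[in LHS](odd_double_half (m' + corank v)) (negPf e_even).
Qed.

Definition excess0 k s : rat :=
  if odd (m' + k) then - (beta k s)%:~R * (p%:R - 1) else 0.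

Lemma excess0E v : (f v 0)%:~R = excess0 (corank v) (pos v).
Proof.
rewrite /excess0; case: ifPn => [/trform_even ->|/trform_odd[-> _ _] //].
by rewrite zker0 rmorphM rmorphN rmorphB.
Qed.

(** The sum of [I] over the weights obtained from one form of corank k and sign s, for all (c, h).
    [D] is the weight belonging to p^(m-1) zeros, and a fiber of excess z gives weight D - z. *)
Definition class_weight (I : rat -> rat) k s : rat :=
  let D : rat := q%:R - (p ^ m')%:R in
  (q%:R - q%:R / (p ^ k)%:R) * p%:R * I D + q%:R / (p ^ k)%:R *
  (if odd (m' + k)
   then I (D + (beta k s)%:~R * (p%:R - 1)) + (p%:R - 1) * I (D - (beta k s)%:~R)
   else I D + (p%:R - 1) / 2 *
        (I (D - (p ^ (m' + k)./2)%:R) + I (D + (p ^ (m' + k)./2)%:R))).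

Lemma class_weightE v (I : rat -> rat) :
  \sum_c \sum_h I (q%:R - (zcount v c h)%:R) = class_weight I (corank v) (pos v).
Proof.
rewrite (sum_zcount v (fun z => I (q%:R - z%:R))) /class_weight card_radicalE.
congr (_ + _ * _).
pose phi (z : int) := I (q%:R - (p ^ m')%:R - z%:~R).
transitivity (\sum_t phi (f v t)).
  apply: eq_bigr => t _; congr I; rewrite /excess rmorphB /= -!pmulrn.
  by ring.
case: ifPn => [/trform_even|/trform_odd[]].
  move/(sum_excess_even p_pr phi) ->; rewrite /phi rmorphM rmorphN rmorphB /=.
  by rewrite mulNr opprK -pmulrn.
move=> f0 f2 fs; rewrite (sum_excess_odd p_pr p_odd phi f0 f2 fs) /phi.
by rewrite rmorphN /= subr0 opprK -pmulrn.
Qed.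

(** The zero form has corank m, rank 0 and positive excess at 0, so [class_weightE] covers it. The
    last two terms are the zero word and the nonzero constant words. *)
Lemma weight_zero (I : rat -> rat) :
  \sum_c \sum_h I (q%:R - (zcount 0 c h)%:R) =
  (q%:R - 1) * p%:R * I (q%:R - (p ^ m')%:R) + I 0 + (p%:R - 1) * I q%:R.
Proof.
have q_gt0 : (0 < q)%N by rewrite expn_gt0 prime_gt0.
have nz_q : q%:R != 0 :> rat by rewrite pnatr_eq0 gtn_eqF.
rewrite class_weightE corank0 /class_weight divff // mul1r addnS oddS addnn odd_double /=.
have -> : beta m'.+1 (pos 0) = - (p ^ m')%N%:Z.
  rewrite /beta addnS addnn -uphalfE uphalf_double.
  have -> : pos 0; last by rewrite mulN1r.
  rewrite /pos -(pmulr_rgt0 _ (_ : 0 < p%:Z)) ?excess00; last first.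
    by rewrite ltz_nat prime_gt0.
  by have := prime_gt1 p_pr; nia.
rewrite rmorphN /= -pmulrn opprK subrK -[RHS]addrA; congr (_ + (I _ + _)).
by rewrite expnS natrM; ring.
Qed.

Lemma class_eq0 :
  \sum_(k < 3) ((class_card k true)%:R + (class_card k false)%:R) = q%:R ^+ 2 - 1 :> rat.
Proof.
have := class_sum (fun _ _ => 1).
under [RHS]eq_bigr do rewrite !mulr1; move=> <-.
rewrite sumr_const (eq_card (B := predC1 (0 : (F * F)%type))) //.
rewrite cardC1 card_prod cardF -subn1.
by rewrite natrB ?muln_gt0 ?expn_gt0 ?prime_gt0 // natrM.
Qed.

Lemma class_sum_int (G : nat -> bool -> rat) (g : F * F -> int) z :
    (forall v, (g v)%:~R = G (corank v) (pos v)) -> \sum_(v : F * F | v != 0) g v = z ->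
  \sum_(k < 3) ((class_card k true)%:R * G k true + (class_card k false)%:R * G k false)
    = z%:~R.
Proof.
by move=> gG <-; rewrite -class_sum rmorph_sum; apply: eq_bigr => v _; rewrite -gG.
Qed.

Let p1_neq0 : p%:Z - 1 != 0.
Proof. by have := prime_gt1 p_pr; lia. Qed.

Let qz_neq0 : q%:Z != 0.
Proof. by rewrite eqz_nat -lt0n expn_gt0 prime_gt0. Qed.

Lemma class_eq1 :
  \sum_(k < 3) ((class_card k true)%:R * (p%:R * excess0 k true) +
                (class_card k false)%:R * (p%:R * excess0 k false)) =
  (p%:R - 1) * q%:R * (q%:R - 1).
Proof.
rewrite (class_sum_int (G := fun k s => p%:R * excess0 k s)
  (g := fun v => p%:Z * f v 0) (z := (p%:Z - 1) * q%:Z * (q%:Z - 1))).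
- by rewrite !rmorphM !rmorphB.
- by move=> v; rewrite rmorphM /= excess0E.
apply: (addrI (p%:Z * f 0 0)); have := moment1.
rewrite (bigD1 (0 : (F * F)%type)) //= => ->.
by rewrite excess00; ring.
Qed.

Lemma class_eq2 :
  \sum_(k < 3) ((class_card k true)%:R * (p ^ k)%:R +
                (class_card k false)%:R * (p ^ k)%:R) =
  2 * q%:R * (q%:R - 1) :> rat.
Proof.
rewrite (class_sum_int (G := fun k s => (p ^ k)%:R)
  (g := fun v => (rho v)%:Z) (z := 2 * q%:Z * (q%:Z - 1))).
- by rewrite !rmorphM !rmorphB.
- by move=> v; rewrite card_radicalE.
apply: (mulfI (mulf_neq0 p1_neq0 qz_neq0)); rewrite mulr_sumr.
apply: (addrI ((p%:Z - 1) * q%:Z * (rho 0)%:Z)).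
have := moment2; rewrite (bigD1 (0 : (F * F)%type)) //= => ->.
by rewrite card_radical0; ring.
Qed.

(** The zero form alone accounts for the whole of [moment2_nonsquare], so the contributions of the
    nonzero forms cancel. *)
Lemma class_eq2_nonsquare :
  \sum_(k < 3) ((class_card k true)%:R * ((-1) ^+ (~~ odd (m' + k)) * (p ^ k)%:R) +
                (class_card k false)%:R * ((-1) ^+ (~~ odd (m' + k)) * (p ^ k)%:R)) = 0
  :> rat.
Proof.
rewrite (class_sum_int (G := fun k s => (-1) ^+ (~~ odd (m' + k)) * (p ^ k)%:R)
  (g := fun v => (-1) ^+ (~~ odd (m' + corank v)) * (rho v)%:Z) (z := 0)) //.
- by move=> v; rewrite card_radicalE rmorphM rmorphXn rmorphN.
apply: (mulfI (mulf_neq0 p1_neq0 qz_neq0)); rewrite mulr_sumr mulr0.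
apply: (addrI ((p%:Z - 1) * q%:Z * (rho 0)%:Z)).
have := moment2_nonsquare; rewrite (bigD1 (0 : (F * F)%type)) //= corank0.
rewrite addnS addnn oddS odd_double /=.
rewrite mul1r => E.
transitivity ((p%:Z - 1) * q%:Z ^+ 2); last by rewrite card_radical0; ring.
rewrite -[RHS]E; congr (_ + _); apply: eq_bigr => v _.
by rewrite mulrCA.
Qed.

Lemma class_eq3 :
  \sum_(k < 3) ((class_card k true)%:R * (p%:R * excess0 k true * (p ^ k)%:R) +
                (class_card k false)%:R * (p%:R * excess0 k false * (p ^ k)%:R)) =
  (p%:R - 1) * q%:R * p%:R * (q%:R - 1).
Proof.
rewrite (class_sum_int (G := fun k s => p%:R * excess0 k s * (p ^ k)%:R)
  (g := fun v => p%:Z * f v 0 * (rho v)%:Z)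
  (z := (p%:Z - 1) * q%:Z * p%:Z * (q%:Z - 1))).
- by rewrite !rmorphM !rmorphB.
- by move=> v; rewrite !rmorphM /= excess0E card_radicalE.
apply: (mulfI qz_neq0); rewrite mulr_sumr.
apply: (addrI (p%:Z * f 0 0 * (q%:Z * (rho 0)%:Z))).
have := moment3; rewrite (bigD1 (0 : (F * F)%type)) //= => E.
transitivity ((p%:Z - 1) * q%:Z ^+ 2 * (q%:Z + (q%:Z - 1) * p%:Z)); last first.
  by rewrite excess00 card_radical0; ring.
by rewrite -[RHS]E; congr (_ + _); apply: eq_bigr => v _; ring.
Qed.

Lemma card_hweight_classes (e : 'I_q -> F) (e_bij : bijective e) (w : nat)
    (I : rat -> rat) : (forall z, I z = (z == w%:R)%:R) -> (2 <= m')%N ->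
  #|[set c in code l charFp e | hweight c == w]|%:R =
  (q%:R - 1) * p%:R * I (q%:R - (p ^ m')%:R) + I 0 + (p%:R - 1) * I q%:R +
  \sum_(k < 3) ((class_card k true)%:R * class_weight I k true +
                (class_card k false)%:R * class_weight I k false).
Proof.
move=> IE m_ge2; rewrite card_hweight // -weight_zero -class_sum.
under [X in _ = _ + X]eq_bigr do rewrite -class_weightE.
rewrite [RHS](_ : _ = \sum_v \sum_c \sum_h I (q%:R - (zcount v c h)%:R)).
  by do 3![apply: eq_bigr => ? _]; rewrite IE.
by rewrite [RHS](bigD1 (0 : (F * F)%type)).
Qed.

(** * The two weight distributions *)

Let natX k : (p ^ k)%:R = p%:R ^+ k :> rat.
Proof. exact: natrX. Qed.

Let betaE k s : (beta k s)%:~R = (-1) ^+ s * p%:R ^+ (m' + k)./2 :> rat.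
Proof. by rewrite /beta rmorphM rmorphXn rmorphN rmorph1 /= -pmulrn natX. Qed.

Variables (e : 'I_q -> F) (e_bij : bijective e).
Hypothesis m_ge2 : (2 <= m')%N.

Lemma class_weight_even (I : rat -> rat) k s (b : rat) :
    odd (m' + k) -> p%:R ^+ (m' + k)./2 = b ->
  class_weight I k s = (q%:R - q%:R / p%:R ^+ k) * p%:R * I (q%:R - (p ^ m')%:R) +
    q%:R / p%:R ^+ k * (if s
      then I (q%:R - (p ^ m')%:R - b * (p%:R - 1)) +
           (p%:R - 1) * I (q%:R - (p ^ m')%:R + b)
      else I (q%:R - (p ^ m')%:R + b * (p%:R - 1)) +
           (p%:R - 1) * I (q%:R - (p ^ m')%:R - b)).
Proof.
move=> ok <-; rewrite /class_weight ok betaE (natX k); case: s => /=.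
  by rewrite mulN1r mulNr opprK.
by rewrite mul1r.
Qed.

Lemma class_weight_odd (I : rat -> rat) k s (d : rat) :
    odd (m' + k) = false -> p%:R ^+ (m' + k)./2 = d ->
  class_weight I k s = (q%:R - q%:R / p%:R ^+ k) * p%:R * I (q%:R - (p ^ m')%:R) +
    q%:R / p%:R ^+ k * (I (q%:R - (p ^ m')%:R) + (p%:R - 1) / 2 *
      (I (q%:R - (p ^ m')%:R - d) + I (q%:R - (p ^ m')%:R + d))).
Proof. by move=> ok <-; rewrite /class_weight ok (natX k) natX. Qed.

Lemma excess0_even k s (b : rat) : odd (m' + k) -> p%:R ^+ (m' + k)./2 = b ->
  excess0 k s = (if s then b else - b) * (p%:R - 1).
Proof.
by move=> ok <-; rewrite /excess0 ok betaE; case: s; rewrite /= ?mulN1r ?opprK ?mul1r.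
Qed.

Lemma excess0_odd k s : odd (m' + k) = false -> excess0 k s = 0.
Proof. by rewrite /excess0 => ->. Qed.

Lemma weight_dist_odd j : m' = (2 * j + 2)%N ->
  weight_dist (code l charFp e) (table_odd p m'.+1).
Proof.
move=> mE w.
have [I IE] : exists I : rat -> rat, forall z, I z = (z == w%:R)%:R.
  by exists (fun z => (z == w%:R)%:R).
rewrite (sum_table _ IE) (card_hweight_classes e_bij IE m_ge2).
have [o0 o1 o2] : [/\ odd (m' + 0) = false, odd (m' + 1) & odd (m' + 2) = false].
  by rewrite mE mul2n !oddD odd_double.
have [h0 h1 h2] : [/\ p%:R ^+ (m' + 0)./2 = p%:R ^+ j * p%:R :> rat,
    p%:R ^+ (m' + 1)./2 = p%:R ^+ j * p%:R :> rat &
    p%:R ^+ (m' + 2)./2 = p%:R ^+ j * p%:R ^+ 2 :> rat].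
  by rewrite -exprSr -exprD mE -!divn2; split; congr (_ ^+ _); lia.
have mE' : m'.+1 = (2 * j + 3)%N by rewrite mE; lia.
have qE : q%:R = (p%:R ^+ j) ^+ 2 * p%:R ^+ 3 :> rat.
  by rewrite natX mE' exprD mulnC exprM.
have CE : (p ^ m')%:R = (p%:R ^+ j) ^+ 2 * p%:R ^+ 2 :> rat.
  by rewrite natX mE exprD mulnC exprM.
rewrite [RHS](_ : _ = \sum_(r <- table_odd p (2 * j + 3)) I r.1 * r.2); last first.
  by rewrite mE'.
rewrite -(@table_odd_sum p j (prime_gt1 p_pr) I
  (class_card 0 true)%:R (class_card 0 false)%:R (class_card 1 true)%:R
  (class_card 1 false)%:R (class_card 2 true)%:R (class_card 2 false)%:R).
- rewrite !big_ord_recr big_ord0 /= add0r.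
  rewrite !(class_weight_odd _ _ o0 h0) !(class_weight_even _ _ o1 h1).
  rewrite !(class_weight_odd _ _ o2 h2) CE qE expr0 expr1 divr1.
  by ring.
- by rewrite -qE -class_eq0 !big_ord_recr big_ord0 /= add0r.
- rewrite -qE -class_eq1 !big_ord_recr big_ord0 /= add0r.
  rewrite !(excess0_odd _ o0) !(excess0_even _ o1 h1) !(excess0_odd _ o2).
  by ring.
- rewrite -qE -class_eq2 !big_ord_recr big_ord0 /= add0r !natX.
  by ring.
rewrite -class_eq2_nonsquare !big_ord_recr big_ord0 /= add0r o0 o1 o2 !natX /=.
by ring.
Qed.

Lemma weight_dist_even j : m' = (2 * j + 3)%N ->
  weight_dist (code l charFp e) (table_even p m'.+1).
Proof.
move=> mE w.
have [I IE] : exists I : rat -> rat, forall z, I z = (z == w%:R)%:R.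
  by exists (fun z => (z == w%:R)%:R).
rewrite (sum_table _ IE) (card_hweight_classes e_bij IE m_ge2).
have [o0 o1 o2] : [/\ odd (m' + 0), odd (m' + 1) = false & odd (m' + 2)].
  by rewrite mE mul2n !oddD odd_double.
have [h0 h1 h2] : [/\ p%:R ^+ (m' + 0)./2 = p%:R ^+ j * p%:R :> rat,
    p%:R ^+ (m' + 1)./2 = p%:R ^+ j * p%:R ^+ 2 :> rat &
    p%:R ^+ (m' + 2)./2 = p%:R ^+ j * p%:R ^+ 2 :> rat].
  by rewrite -exprSr -exprD mE -!divn2; split; congr (_ ^+ _); lia.
have mE' : m'.+1 = (2 * j + 4)%N by rewrite mE; lia.
have qE : q%:R = (p%:R ^+ j) ^+ 2 * p%:R ^+ 4 :> rat.
  by rewrite natX mE' exprD mulnC exprM.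
have CE : (p ^ m')%:R = (p%:R ^+ j) ^+ 2 * p%:R ^+ 3 :> rat.
  by rewrite natX mE exprD mulnC exprM.
rewrite [RHS](_ : _ = \sum_(r <- table_even p (2 * j + 4)) I r.1 * r.2); last first.
  by rewrite mE'.
rewrite -(@table_even_sum p j (prime_gt1 p_pr) I
  (class_card 0 true)%:R (class_card 0 false)%:R (class_card 1 true)%:R
  (class_card 1 false)%:R (class_card 2 true)%:R (class_card 2 false)%:R).
- rewrite !big_ord_recr big_ord0 /= add0r.
  rewrite !(class_weight_even _ _ o0 h0) !(class_weight_odd _ _ o1 h1).
  rewrite !(class_weight_even _ _ o2 h2) CE qE expr0 expr1 divr1.
  by ring.
- by rewrite -qE -class_eq0 !big_ord_recr big_ord0 /= add0r.
- rewrite -qE -class_eq1 !big_ord_recr big_ord0 /= add0r.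
  rewrite !(excess0_even _ o0 h0) !(excess0_odd _ o1) !(excess0_even _ o2 h2).
  by ring.
- rewrite -qE -class_eq2 !big_ord_recr big_ord0 /= add0r !natX.
  by ring.
- rewrite -class_eq2_nonsquare !big_ord_recr big_ord0 /= add0r o0 o1 o2 !natX /=.
  by ring.
rewrite -qE -class_eq3 !big_ord_recr big_ord0 /= add0r.
rewrite !(excess0_even _ o0 h0) !(excess0_odd _ o1) !(excess0_even _ o2 h2) !natX.
by ring.
Qed.

End Family.

Theorem theorem3p1 (p m l : nat) (p_pr : prime p) (p_odd : odd p)
    (m_ge3 : (3 <= m)%N) (l_gt0 : (0 < l)%N) (coprime_ml : gcdn m l = 1%N)
    (F : finFieldType) (charFp : p \in [pchar F]%R) (cardF : #|F| = (p ^ m)%N)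
    (e : 'I_(p ^ m) -> F) (e_bij : bijective e) :
  code_dim (code l charFp e) = (3 * m + 1)%N /\
  (odd m -> weight_dist (code l charFp e) (table_odd p m)) /\
  (~~ odd m -> weight_dist (code l charFp e) (table_even p m)).
Proof.
case: m m_ge3 coprime_ml cardF e e_bij => // m'; rewrite ltnS => m_ge2.
move=> co_ml cardF e e_bij.
split; first exact: (code_dimE p_pr).
split=> m_odd.
  have [j mE] : exists j, m' = 2 * j + 2.
    by exists (m' - 2)./2; rewrite mul2n even_halfK ?subnK // oddB // addbF.
  by apply: weight_dist_odd mE.
(* An even m is at least 4, so m' - 3 is a true difference. *)
have m_ge3 : 2 < m' by rewrite ltn_neqAle m_ge2 andbT; apply: contraNneq m_odd => <-.
have [j mE] : exists j, m' = 2 * j + 3.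
  by exists (m' - 3)./2; rewrite mul2n even_halfK ?subnK // oddB // addbT.
by apply: weight_dist_even mE.
Qed.
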